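(* Let $\rho>0$. The set of real analytic diffeomorphisms of $\mathbb{T}^2$ which belong to $\overline{\mathcal{O}}^\omega_\rho(\mathbb{T}^2)$ and are weak spreading is residual in $\overline{\mathcal{O}}^\omega_\rho(\mathbb{T}^2)$ (with the topology induced by the metric $d_\rho$).
   Context: Let $\mathbb{T}^2=\mathbb{R}^2/\mathbb{Z}^2$ with quotient projection $\pi\colon\mathbb{R}^2\to\mathbb{T}^2$. A lift of a homeomorphism $f$ of $\mathbb{T}^2$ is a map $\hat f\colon\mathbb{R}^2\to\mathbb{R}^2$ with $f\pi=\pi\hat f$; if $f$ is homotopic to the identity, then $\hat f-\mathrm{id}$ is $\mathbb{Z}^2$-periodic and is called the periodic part of $\hat f$. For $\alpha=(\alpha_1,\alpha_2)\in\mathbb{T}^2$, $R_\alpha\colon\mathbb{T}^2\to\mathbb{T}^2$ is the translation $(x,y)\mapsto(x+\alpha_1,y+\alpha_2)$. Fix $\rho>0$ and let $A_\rho=\{(z,w)\in\mathbb{C}^2: |\operatorname{Im} z|<\rho,\ |\operatorname{Im} w|<\rho\}$. For a real analytic $\mathbb{Z}^2$-periodic function $g\colon\mathbb{R}^2\to\mathbb{R}^2$ which extends holomorphically to $A_\rho$, put $\|g\|_\rho=\sup_{(z,w)\in A_\rho}|g(z,w)|$ (using the extension), and let $C^\omega_\rho(\mathbb{T}^2)$ be the space of all such functions with $\|g\|_\rho<\infty$. Let $\mathrm{Diff}^\omega_\rho(\mathbb{T}^2)$ be the space of all diffeomorphisms of $\mathbb{T}^2$ which are homotopic to the identity and have a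 lift whose periodic part is in $C^\omega_\rho(\mathbb{T}^2)$, with the metric $$d_\rho(h,k)=\inf_{(p,q)\in\mathbb{Z}^2}\|\hat h-\hat k+(p,q)\|_\rho,$$ where $\hat h,\hat k$ are lifts of $h,k$. Let $\overline{\mathcal{O}}^\omega_\rho(\mathbb{T}^2)$ be the closure, in the metric $d_\rho$, of the set of diffeomorphisms of the form $hR_\alpha h^{-1}$, where $\alpha\in\mathbb{T}^2$ and $h\in\mathrm{Diff}^\omega_\rho(\mathbb{T}^2)$ is any diffeomorphism whose lifts to $\mathbb{R}^2$ have a bi-holomorphic extension to $\mathbb{C}^2$. A homeomorphism $f\colon\mathbb{T}^2\to\mathbb{T}^2$ is weak spreading if for a lift $\hat f\colon\mathbb{R}^2\to\mathbb{R}^2$ of $f$ the following holds: for each nonempty open set $U\subset\mathbb{R}^2$, each $\epsilon>0$ and each $N>0$, there is an integer $n>0$ such that $\hat f^n(U)$ is $\epsilon$-dense in a ball of radius $N$ (i.e. there is a ball $B\subset\mathbb{R}^2$ of radius $N$ such that every point of $B$ is within distance $\epsilon$ of $\hat f^n(U)$). A subset of a topological space is residual if it contains a countable intersection of open dense sets. *)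

(* Defs.v *)
From HB Require Import structures.
From mathcomp Require Import all_boot all_order all_algebra.
From mathcomp Require Import generic_quotient ring_quotient.
From mathcomp Require Import complex zify ring lra.
From mathcomp Require Import all_classical all_reals all_analysis.

Set Implicit Arguments.
Unset Strict Implicit.
Unset Printing Implicit Defensive.

Import Order.TTheory GRing.Theory Num.Theory.
Import numFieldNormedType.Exports.

Local Open Scope classical_set_scope.
Local Open Scope ring_scope.
Local Open Scope quotient_scope.

Definition Zlattice (R : realType) : {pred R * R} :=
  fun x => (x.1 \is a Num.int) && (x.2 \is a Num.int).

Lemma Zlattice_zmod_closed (R : realType) : zmod_closed (@Zlattice R).
Proof.
split=> [|x y /andP[x1 x2] /andP[y1 y2]]; first by rewrite unfold_in !rpred0.
by rewrite unfold_in !rpredB.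
Qed.

HB.instance Definition _ (R : realType) :=
  GRing.isZmodClosed.Build (R * R)%type (@Zlattice R) (@Zlattice_zmod_closed R).

Definition torus (R : realType) : Type :=
  quotient_topology (Quotient.quot (@Zlattice R)).

HB.instance Definition _ (R : realType) := Topological.on (torus R).
HB.instance Definition _ (R : realType) := Quotient.on (torus R).
HB.instance Definition _ (R : realType) :=
  GRing.Zmodule.copy (torus R) (Quotient.quot (@Zlattice R)).

Definition torus_pi (R : realType) (x : R * R) : torus R := \pi_(torus R) x.

Definition rotation (R : realType) (a : torus R) : torus R -> torus R :=
  fun x => x + a.

Definition norm2 (R : realType) (x : R * R) : R :=
  Num.sqrt (x.1 ^+ 2 + x.2 ^+ 2).

(* Continuity is part of being a lift: without it the periodic part of a lift
   need not be periodic, and two lifts need not differ by an element of Z^2. *)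
Definition is_lift (R : realType) (f : torus R -> torus R)
    (F : R * R -> R * R) : Prop :=
  continuous F /\ forall x, f (torus_pi x) = torus_pi (F x).

Definition homotopic_to_id (R : realType) (f : torus R -> torus R) : Prop :=
  exists H : R * torus R -> torus R,
    [/\ {within `[0, 1]%classic `*` [set: torus R], continuous H},
        forall x, H (0, x) = x &
        forall x, H (1, x) = f x].

Fixpoint class_C (R : realType) (k : nat) (F : R * R -> R * R) : Prop :=
  continuous F /\
  if k is k'.+1 then
    [/\ forall x, derivable F x (1, 0) /\ derivable F x (0, 1),
        class_C k' ('D_(1, 0) F) &
        class_C k' ('D_(0, 1) F)]
  else True.

(* Every continuous map of the torus has a lift, and it is smooth in the charts
   given by local inverses of torus_pi if and only if a lift is smooth.  When
   a diffeomorphism has an analytic lift, as in Diff_omega below, the lifts of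
   its inverse are analytic as well by the inverse function theorem. *)
Definition smooth (R : realType) (f : torus R -> torus R) : Prop :=
  exists F, is_lift f F /\ forall k, class_C k F.

Definition diffeomorphism (R : realType) (f : torus R -> torus R) : Prop :=
  exists g, [/\ cancel f g, cancel g f, smooth f & smooth g].

(* The complex numbers as a normed space over themselves, so that
   [differentiable] below is Frechet differentiability over C. *)
Definition Cplx (R : realType) : numFieldType := R[i].

Definition embC2 (R : realType) (x : R * R) : Cplx R * Cplx R :=
  (x.1%:C%C, x.2%:C%C).

Definition normC2 (R : realType) (z : Cplx R * Cplx R) : R :=
  norm2 (ComplexField.Normc.normc z.1, ComplexField.Normc.normc z.2).

Definition strip (R : realType) (rho : R) : set (Cplx R * Cplx R) :=
  [set z | `|complex.Im z.1| < rho /\ `|complex.Im z.2| < rho].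

Definition holomorphic_on (R : realType) (A : set (Cplx R * Cplx R))
    (G : Cplx R * Cplx R -> Cplx R * Cplx R) : Prop :=
  forall z, A z -> differentiable G z.

Definition extends (R : realType) (G : Cplx R * Cplx R -> Cplx R * Cplx R)
    (g : R * R -> R * R) : Prop :=
  forall x, G (embC2 x) = embC2 (g x).

Definition holomorphic_extension (R : realType) (rho : R) (g : R * R -> R * R) :
    set (Cplx R * Cplx R -> Cplx R * Cplx R) :=
  [set G | holomorphic_on (strip rho) G /\ extends G g].

Definition sup_strip (R : realType) (rho : R)
    (G : Cplx R * Cplx R -> Cplx R * Cplx R) : \bar R :=
  ereal_sup [set (normC2 (G z))%:E | z in strip rho].

(* A holomorphic extension to the strip is unique there, so the infimum is
   over at most one value; it is +oo when there is no extension. *)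
Definition norm_strip (R : realType) (rho : R) (g : R * R -> R * R) : \bar R :=
  ereal_inf [set sup_strip rho G | G in holomorphic_extension rho g].

Definition Z2_periodic (R : realType) (g : R * R -> R * R) : Prop :=
  forall (x : R * R) (p q : int), g (x + (p%:~R, q%:~R)) = g x.

(* Real analyticity is implied by the existence of the extension. *)
Definition C_omega (R : realType) (rho : R) : set (R * R -> R * R) :=
  [set g | [/\ Z2_periodic g,
               exists G, holomorphic_extension rho g G &
               (norm_strip rho g < +oo)%E]].

Definition biholomorphic_extension (R : realType) (F : R * R -> R * R) : Prop :=
  exists G K : Cplx R * Cplx R -> Cplx R * Cplx R,
    [/\ extends G F, cancel G K, cancel K G,
        holomorphic_on setT G & holomorphic_on setT K].

Record Diff_omega (R : realType) (rho : {posnum R}) := MkDiffOmega {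
  diff_fun :> torus R -> torus R;
  diff_diffeo : diffeomorphism diff_fun;
  diff_homotopic : homotopic_to_id diff_fun;
  diff_lift : exists2 F, is_lift diff_fun F &
                C_omega rho%:num (fun x => F x - x) }.

HB.instance Definition _ (R : realType) (rho : {posnum R}) :=
  gen_eqMixin (Diff_omega rho).
HB.instance Definition _ (R : realType) (rho : {posnum R}) :=
  gen_choiceMixin (Diff_omega rho).

(* Two lifts of a map differ by an element of Z^2, so the infimum does not
   change when the lifts H and K are fixed. *)
Definition edist_rho (R : realType) (rho : {posnum R}) (h k : Diff_omega rho) :
    \bar R :=
  ereal_inf [set e | exists H K (p q : int), [/\ is_lift h H, is_lift k K &
    e = norm_strip rho%:num (fun x => H x - K x + (p%:~R, q%:~R))]].

(* No information is lost by fine, see edist_rho_fin_num. *)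
Definition dist_rho (R : realType) (rho : {posnum R}) (h k : Diff_omega rho) :
  R := fine (edist_rho h k).

Section norms.
Variable R : realType.
Implicit Types (x y : R * R) (z w : Cplx R * Cplx R).

Lemma norm2_ge0 x : 0 <= norm2 x.
Proof. exact: sqrtr_ge0. Qed.

Lemma ler_norm2D x y : norm2 (x + y) <= norm2 x + norm2 y.
Proof.
case: x y => [a b] [c d]; rewrite /norm2 /=.
set p := a ^+ 2 + b ^+ 2; set q := c ^+ 2 + d ^+ 2.
have p0 : 0 <= p by rewrite addr_ge0 ?sqr_ge0.
have q0 : 0 <= q by rewrite addr_ge0 ?sqr_ge0.
have s0 : 0 <= Num.sqrt p + Num.sqrt q by rewrite addr_ge0 ?sqrtr_ge0.
rewrite -(ger0_norm s0) -sqrtr_sqr; apply: ler_wsqrtr.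
rewrite [leRHS]sqrrD !sqr_sqrtr//.
have key : a * c + b * d <= Num.sqrt p * Num.sqrt q.
  rewrite -sqrtrM//; apply: le_trans (ler_norm _) _; rewrite -sqrtr_sqr.
  apply: ler_wsqrtr; rewrite -subr_ge0.
  have -> : p * q - (a * c + b * d) ^+ 2 = (a * d - b * c) ^+ 2.
    by rewrite /p /q; ring.
  exact: sqr_ge0.
by rewrite -mulr_natl /p /q; lra.
Qed.

Lemma ler_norm2 (a b c d : R) : 0 <= a <= c -> 0 <= b <= d ->
  norm2 (a, b) <= norm2 (c, d).
Proof.
move=> /andP[a0 ac] /andP[b0 bd]; apply: ler_wsqrtr => /=.
by apply: lerD; rewrite ler_pXn2r// nnegrE; lra.
Qed.

Lemma norm2_fst x : `|x.1| <= norm2 x.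
Proof. by rewrite -sqrtr_sqr; apply: ler_wsqrtr; rewrite lerDl sqr_ge0. Qed.

Lemma norm2_snd x : `|x.2| <= norm2 x.
Proof. by rewrite -sqrtr_sqr; apply: ler_wsqrtr; rewrite lerDr sqr_ge0. Qed.

Lemma norm2_eq0 x : norm2 x = 0 -> x = 0.
Proof.
move=> x0; have := norm2_fst x; have := norm2_snd x; rewrite x0 !normr_le0.
by case: x {x0} => a b /= /eqP -> /eqP ->.
Qed.

Lemma normcE (a : R[i]) :
  ComplexField.Normc.normc a = norm2 (complex.Re a, complex.Im a).
Proof. by case: a. Qed.

Lemma normcD (a b : R[i]) : ComplexField.Normc.normc (a + b) <=
  ComplexField.Normc.normc a + ComplexField.Normc.normc b.
Proof.
case: a b => [a1 a2] [b1 b2]; rewrite !normcE.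
exact: (ler_norm2D (a1, a2) (b1, b2)).
Qed.

Lemma normcN (a : R[i]) :
  ComplexField.Normc.normc (- a) = ComplexField.Normc.normc a.
Proof. by case: a => a b /=; rewrite !sqrrN. Qed.

Lemma normc_ge0 (a : R[i]) : 0 <= ComplexField.Normc.normc a.
Proof. by rewrite normcE norm2_ge0. Qed.

Lemma normc_real (a : R) : ComplexField.Normc.normc (a%:C)%C = `|a|.
Proof. by rewrite /= expr0n addr0 sqrtr_sqr. Qed.

Lemma normC2_ge0 z : 0 <= normC2 z.
Proof. exact: norm2_ge0. Qed.

Lemma ler_normC2D z w : normC2 (z + w) <= normC2 z + normC2 w.
Proof.
apply: le_trans (ler_norm2D _ _).
by apply: ler_norm2; rewrite normc_ge0 normcD.
Qed.

Lemma normC2N z : normC2 (- z) = normC2 z.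
Proof. by rewrite /normC2 /= !normcN. Qed.

Lemma normC2_embC2 x : normC2 (embC2 x) = norm2 x.
Proof.
rewrite /normC2 /norm2 /= !expr0n !addr0 !sqrtr_sqr.
by rewrite !real_normK ?num_real.
Qed.

Lemma embC2D x y : embC2 (x + y) = embC2 x + embC2 y.
Proof. by rewrite /embC2 /= !rmorphD. Qed.

Lemma embC2N x : embC2 (- x) = - embC2 x.
Proof. by rewrite /embC2 /= !rmorphN. Qed.

Lemma strip_embC2 (rho : {posnum R}) x : strip rho%:num (embC2 x).
Proof. by split; rewrite /= normr0. Qed.

End norms.

Section norm_strip_theory.
Variables (R : realType) (rho : {posnum R}).
Implicit Types g k : R * R -> R * R.
Local Notation norm_strip := (norm_strip rho%:num).

Lemma norm_strip_ge g (x : R * R) : ((norm2 (g x))%:E <= norm_strip g)%E.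
Proof.
apply: le_ereal_inf_tmp => _ [G [_ Gg] <-].
rewrite -normC2_embC2 -Gg; apply: ereal_sup_ubound.
by exists (embC2 x) => //; exact: strip_embC2.
Qed.

Lemma norm_strip_ge0 g : (0 <= norm_strip g)%E.
Proof. by apply: le_trans (norm_strip_ge g 0); rewrite lee_fin norm2_ge0. Qed.

Lemma norm_strip_triangle g k :
  (norm_strip (fun x => (g x + k x)%R) <= norm_strip g + norm_strip k)%E.
Proof.
have [->|gfin] := eqVneq (norm_strip g) +oo%E.
  by rewrite addye ?leey// gt_eqF// (lt_le_trans _ (norm_strip_ge0 k))// ltNyr.
have [->|kfin] := eqVneq (norm_strip k) +oo%E.
  by rewrite addey ?leey// gt_eqF// (lt_le_trans _ (norm_strip_ge0 g))// ltNyr.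
have gf : norm_strip g \is a fin_num.
  by rewrite ge0_fin_numE ?norm_strip_ge0// lt_neqAle gfin leey.
have kf : norm_strip k \is a fin_num.
  by rewrite ge0_fin_numE ?norm_strip_ge0// lt_neqAle kfin leey.
apply/lee_addgt0Pr => e e0.
have e20 : 0 < e / 2 by rewrite divr_gt0.
have [_ [G [hG eG] <-] ltG] := lb_ereal_inf_adherent e20 gf.
have [_ [K [hK eK] <-] ltK] := lb_ereal_inf_adherent e20 kf.
have -> : (norm_strip g + norm_strip k + e%:E =
  (norm_strip g + (e / 2)%:E) + (norm_strip k + (e / 2)%:E))%E.
  by rewrite addeACA -EFinD -splitr.
apply: le_trans (leeD (ltW ltG) (ltW ltK)).
apply: (@le_trans _ _ (sup_strip rho%:num (fun z => G z + K z))).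
  apply: ereal_inf_lbound; exists (fun z => G z + K z) => //; split.
    by move=> z Az; apply: differentiableD; [exact: hG|exact: hK].
  by move=> x; rewrite eG eK embC2D.
apply: ge_ereal_sup => _ [z Az <-].
apply: (@le_trans _ _ ((normC2 (G z))%:E + (normC2 (K z))%:E)%E).
  by rewrite -EFinD lee_fin ler_normC2D.
by apply: leeD; apply: ereal_sup_ubound; exists z.
Qed.

Let norm_stripN_le g : (norm_strip (fun x => (- g x)%R) <= norm_strip g)%E.
Proof.
apply: le_ereal_inf_tmp => _ [G [hG eG] <-].
apply: ereal_inf_lbound; exists (fun z => - G z); first split.
- by move=> z Az; apply: differentiableN; exact: hG.
- by move=> x; rewrite eG embC2N.
- by congr ereal_sup; apply: eq_imagel => z _; rewrite normC2N.
Qed.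

Lemma norm_stripN g : norm_strip (fun x => - g x) = norm_strip g.
Proof.
apply/eqP; rewrite eq_le norm_stripN_le /=.
have := norm_stripN_le (fun x => - g x).
by under [X in norm_strip X]eq_fun do rewrite opprK.
Qed.

Lemma norm_strip0 : norm_strip (fun=> 0) = 0%E.
Proof.
apply/eqP; rewrite eq_le norm_strip_ge0 andbT.
apply: (@le_trans _ _ (sup_strip rho%:num (fun=> 0))).
  apply: ereal_inf_lbound; exists (fun=> 0) => //; split=> [z _|x].
    exact: (@differentiable_cst _ _ _ 0).
  by rewrite /embC2 /= !rmorph0.
apply: ge_ereal_sup => _ [z Az <-].
by rewrite /normC2 /norm2 /= !(expr0n, addr0, sqrtr0).
Qed.

End norm_strip_theory.

Section lifts.
Variable R : realType.
Implicit Types (x y : R * R) (f g : torus R -> torus R).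

Lemma torus_pi_reprK (t : torus R) : torus_pi (repr t) = t.
Proof. exact: reprK. Qed.

Lemma torus_pi_eqP x y : torus_pi x = torus_pi y <-> x - y \in @Zlattice R.
Proof.
rewrite Quotient.idealrBE; split=> [h|/eqP h]; last exact: h.
by apply/eqP; exact: h.
Qed.

Lemma torus_piD x y : torus_pi (x + y) = torus_pi x + torus_pi y.
Proof. exact: (Quotient.pi_add (@Zlattice R)). Qed.

Lemma torus_pi_int x (p q : int) : torus_pi (x + (p%:~R, q%:~R)) = torus_pi x.
Proof.
by apply/torus_pi_eqP; rewrite addrC addKr unfold_in /= !intr_int.
Qed.

Let int_continuous_cst (u : R * R -> R) :
  continuous u -> (forall x, u x \is a Num.int) -> forall x, u x = u 0.
Proof.
move=> cu iu x; apply/eqP/negPn/negP => ux.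
pose w t := u (t *: x).
have cw : continuous w.
  move=> t; apply: (@continuous_comp _ _ _ (fun t : R => t *: x) u).
    exact: scalel_continuous.
  exact: cu.
have w0 : w 0 = u 0 by rewrite /w scale0r.
have w1 : w 1 = u x by rewrite /w scale1r.
have [m wm] := intrP (iu 0); have [n wn] := intrP (iu x).
have mn : m != n by apply: contra ux => /eqP mn; rewrite wm wn mn.
pose c : int := Num.min m n.
have cm : Num.min (w 0) (w 1) <= c%:~R + 2^-1 <= Num.max (w 0) (w 1).
  rewrite w0 w1 wm wn /c; move: mn; case: (ltgtP m n) => // mn _.
    have : (m + 1)%:~R <= n%:~R :> R by rewrite ler_int; lia.
    by rewrite intrD minEle maxEle; case: ifP => h; lra.
  have : (n + 1)%:~R <= m%:~R :> R by rewrite ler_int; lia.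
  by rewrite intrD minEle maxEle; case: ifP => h; lra.
have [t _ wt] := IVT (ler01 : (0 : R) <= 1) (continuous_subspaceT cw) cm.
have [k wk] := intrP (iu (t *: x)).
have : ((2 * (k - c))%:~R = 1%:~R :> R).
  rewrite intrM intrB -wk -/(w t) wt; lra.
by move/eqP; rewrite eqr_int; lia.
Qed.

Lemma lift_unique f (F G : R * R -> R * R) : is_lift f F -> is_lift f G ->
  exists p q : int, forall x, F x = G x + (p%:~R, q%:~R).
Proof.
move=> [cF fF] [cG fG].
have FG x : F x - G x \in @Zlattice R by apply/torus_pi_eqP; rewrite -fF -fG.
have c1 : continuous (fun x => (F x - G x).1).
  move=> x; apply: (@continuous_comp _ _ _ (fun x => F x - G x) fst).
    by apply: continuousB; [exact: cF|exact: cG].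
  exact: cvg_fst.
have c2 : continuous (fun x => (F x - G x).2).
  move=> x; apply: (@continuous_comp _ _ _ (fun x => F x - G x) snd).
    by apply: continuousB; [exact: cF|exact: cG].
  exact: cvg_snd.
have /andP[/intrP[p p0] /intrP[q q0]] := FG 0.
exists p, q => x; apply/eqP; rewrite addrC -subr_eq; apply/eqP.
have e1 := int_continuous_cst c1 (fun x => proj1 (andP (FG x))) x.
have e2 := int_continuous_cst c2 (fun x => proj2 (andP (FG x))) x.
by rewrite -p0 -q0 -e1 -e2 -surjective_pairing.
Qed.

Lemma int_dist0 (r : R) :
  (forall e : R, 0 < e -> exists m : int, `|r - m%:~R| < e) -> r \is a Num.int.
Proof.
move=> h; apply/negPn/negP => rN.
have d0 : 0 < r - (Num.floor r)%:~R.
  rewrite subr_gt0 lt_neqAle floor_le_tmp andbT.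
  by apply: contra rN => /eqP <-; exact: intr_int.
have d1 : 0 < (Num.floor r)%:~R + 1 - r.
  by rewrite subr_gt0 -intrD1 floorD1_gt.
have [|m] := h (Num.min (r - (Num.floor r)%:~R) ((Num.floor r)%:~R + 1 - r)).
  by rewrite lt_min d0.
rewrite lt_min => /andP[].
have [mf|fm] := leP m (Num.floor r).
  have : m%:~R <= (Num.floor r)%:~R :> R by rewrite ler_int.
  move=> mf'; rewrite ger0_norm; lra.
have : (Num.floor r + 1)%:~R <= m%:~R :> R by rewrite ler_int; lia.
rewrite intrD => mf' _; rewrite ler0_norm; lra.
Qed.

End lifts.

Section dist.
Variables (R : realType) (rho : {posnum R}).
Implicit Types h k l : Diff_omega rho.
Local Notation N := (norm_strip rho%:num).

Lemma edist_rho_ge0 h k : (0 <= edist_rho h k)%E.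
Proof.
by apply: le_ereal_inf_tmp => _ [H [K [p [q [_ _ ->]]]]]; exact: norm_strip_ge0.
Qed.

Lemma edist_rho_fin_num h k : edist_rho h k \is a fin_num.
Proof.
rewrite ge0_fin_numE ?edist_rho_ge0//.
have [H hH [_ _ NH]] := diff_lift h; have [K kK [_ _ NK]] := diff_lift k.
apply: (@le_lt_trans _ _
  (N (fun x => (H x - x)%R) + N (fun x => (- (K x - x))%R))%E).
  apply: le_trans (norm_strip_triangle _ _ _).
  apply: ereal_inf_lbound; exists H, K, 0, 0; split=> //.
  congr norm_strip; apply/funext => x.
  have -> : ((0 : int)%:~R, (0 : int)%:~R) = 0 :> R * R by [].
  by rewrite addr0 opprB addrA subrK.
by rewrite norm_stripN; exact: lte_add_pinfty.
Qed.

Lemma edist_rhoE h k : edist_rho h k = (dist_rho h k)%:E.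
Proof. by rewrite /dist_rho fineK// edist_rho_fin_num. Qed.

Lemma dist_rhoxx h : dist_rho h h = 0.
Proof.
apply/EFin_inj; rewrite -edist_rhoE; apply/eqP.
rewrite eq_le edist_rho_ge0 andbT.
apply: (@le_trans _ _ (N (fun=> 0))); last by rewrite norm_strip0.
have [H hH _] := diff_lift h.
apply: ereal_inf_lbound; exists H, H, 0, 0; split=> //.
by congr norm_strip; apply/funext => x; rewrite subrr add0r.
Qed.

Let edist_sym_le h k : (edist_rho h k <= edist_rho k h)%E.
Proof.
apply: le_ereal_inf_tmp => _ [K [H [p [q [kK hH ->]]]]].
apply: ereal_inf_lbound; exists H, K, (- p), (- q); split=> //.
rewrite -norm_stripN; congr norm_strip; apply/funext => x.
by rewrite opprD opprB !intrN.
Qed.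

Lemma dist_rho_sym h k : dist_rho h k = dist_rho k h.
Proof.
by apply/EFin_inj; rewrite -!edist_rhoE; apply/eqP; rewrite eq_le !edist_sym_le.
Qed.

Lemma dist_rho_triangle k h l : dist_rho h l <= dist_rho h k + dist_rho k l.
Proof.
rewrite -lee_fin EFinD -!edist_rhoE.
apply/lee_addgt0Pr => e e0; have e20 : 0 < e / 2 by rewrite divr_gt0.
have [_ [H [K [p [q [hH kK ->]]]]] lt1] :=
  lb_ereal_inf_adherent e20 (edist_rho_fin_num h k).
have [_ [K' [L [p' [q' [kK' lL ->]]]]] lt2] :=
  lb_ereal_inf_adherent e20 (edist_rho_fin_num k l).
have -> : (edist_rho h k + edist_rho k l + e%:E =
  (edist_rho h k + (e / 2)%:E) + (edist_rho k l + (e / 2)%:E))%E.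
  by rewrite addeACA -EFinD -splitr.
apply: le_trans (leeD (ltW lt1) (ltW lt2)).
apply: le_trans (norm_strip_triangle _ _ _).
have [m [n KK']] := lift_unique kK' kK.
apply: ereal_inf_lbound; exists H, L, (p + p' + m), (q + q' + n); split=> //.
congr norm_strip; apply/funext => x; rewrite KK' !intrD.
by congr pair => /=; ring.
Qed.

Lemma Diff_omega_inj h k : h =1 k -> h = k.
Proof.
case: h k => [h h1 h2 h3] [k k1 k2 k3] /= /funext hk; subst k.
by congr MkDiffOmega; exact: Prop_irrelevance.
Qed.

Lemma dist_rho_positivity h k : dist_rho h k = 0 -> h = k.
Proof.
move=> d0; apply: Diff_omega_inj => t; rewrite -(torus_pi_reprK t).
set x := repr t.
rewrite -(torus_pi_reprK (h _)) -(torus_pi_reprK (k _)).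
set u := repr (h _); set v := repr (k _).
have close (e : R) : 0 < e -> exists m n : int,
    `|(u - v).1 - m%:~R| < e /\ `|(u - v).2 - n%:~R| < e.
  move=> e0; have : (edist_rho h k < e%:E)%E by rewrite edist_rhoE d0 lte_fin.
  move=> /ereal_inf_lt[_ [H [K [p [q [[_ hH] [_ kK] ->]]]]]].
  move=> /(le_lt_trans (norm_strip_ge _ _ x)); rewrite lte_fin.
  have : H x - u \in @Zlattice R by apply/torus_pi_eqP; rewrite torus_pi_reprK hH.
  move=> /andP[/intrP[a1 +] /intrP[a2 +]].
  have : K x - v \in @Zlattice R by apply/torus_pi_eqP; rewrite torus_pi_reprK kK.
  move=> /andP[/intrP[b1 +] /intrP[b2 +]].
  case: (H x) (K x) u v => [H1 H2] [K1 K2] [u1 u2] [v1 v2] /=.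
  move=> eb1 eb2 ea1 ea2 lte; exists (b1 - a1 - p), (b2 - a2 - q).
  split; apply: le_lt_trans lte.
    apply: le_trans (norm2_fst _); rewrite /= !intrB -ea1 -eb1.
    by rewrite le_eqVlt; apply/orP; left; apply/eqP; congr (`|_|); ring.
  apply: le_trans (norm2_snd _); rewrite /= !intrB -ea2 -eb2.
  by rewrite le_eqVlt; apply/orP; left; apply/eqP; congr (`|_|); ring.
apply/torus_pi_eqP; apply/andP; split; apply: int_dist0 => e e0.
  by have [m [n [? _]]] := close e e0; exists m.
by have [m [n [_ ?]]] := close e e0; exists n.
Qed.

End dist.

HB.instance Definition _ (R : realType) (rho : {posnum R}) :=
  isMetric.Build R (Diff_omega rho) (@dist_rhoxx R rho)
    (@dist_rho_positivity R rho) (@dist_rho_sym R rho)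
    (@dist_rho_triangle R rho).

Definition conjugate_rotations (R : realType) (rho : {posnum R}) :
    set (Diff_omega rho) :=
  [set f | exists (h : Diff_omega rho) (h' : torus R -> torus R) (a : torus R),
    [/\ cancel h h', cancel h' h,
        forall H, is_lift h H -> biholomorphic_extension H &
        f = h \o rotation a \o h' :> (torus R -> torus R)]].
Arguments conjugate_rotations {R} rho.

Definition closure_O (R : realType) (rho : {posnum R}) :
    set (Diff_omega rho) :=
  closure (conjugate_rotations rho).
Arguments closure_O {R} rho.

Definition weak_spreading (R : realType) (f : torus R -> torus R) : Prop :=
  exists2 F, is_lift f F &
    forall (U : set (R * R)) (e N : R),
      open U -> U !=set0 -> 0 < e -> 0 < N ->
      exists n : nat, (0 < n)%N /\
        exists c : R * R, forall x, norm2 (x - c) < N ->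
          exists2 y, U y & norm2 (iter n F y - x) < e.

Definition residual (X : topologicalType) (A : set X) : Prop :=
  exists U : nat -> set X,
    (forall n, open (U n) /\ dense (U n)) /\ \bigcap_n U n `<=` A.

(* Main.v *)
Require Import Defs.
From HB Require Import structures.
From mathcomp Require Import all_boot all_order all_algebra.
From mathcomp Require Import generic_quotient ring_quotient.
From mathcomp Require Import complex zify ring lra.
From mathcomp Require Import all_classical all_reals all_analysis.

(** The proof is a conjugation argument in the style of Anosov and Katok.

    Call a map [f] good for a ball [U] and an integer [k] when some iterate of
    a lift of [f] sends [U] to a set which is 1/k-dense in a ball of radius
    [k].  Two lifts of [f] differ by an integer translation, which only moves
    the centre of that ball, so [f] is weak spreading as soon as it is good
    for all rational balls [U] of radius 1/k and all [k].  These are countably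
    many conditions, and each of them holds on a dense open subset, at least, of the
    closure of the conjugates of rotations: a map which is good with some room
    to spare stays good under uniformly small perturbations
    ([spreading_open]), and good maps are dense ([spreading_dense]).

    For the density, take a conjugate of a rotation [h R_a h^-1], choose a
    rational vector [a' = p / q] near [a], and let [G] be a real analytic
    diffeomorphism commuting with [R_a'].  Then [h G R_b G^-1 h^-1] is close
    to [h R_a' h^-1] when [b] is close enough to [a'], however wild [G] is
    ([rotation_conj_close]).  With [b = a' + t / (m q)] for a large [m], the
    iterate of order [m q] is [h G R_t G^-1 h^-1] up to an integer
    translation.  As [h] moves points by a bounded amount and is uniformly
    continuous, it remains to find [G] and [t] for which [G R_t G^-1] spreads
    a given small open set over a large ball. The composition of a vertical
    shear with a horizontal one, both with profile [N cos (2 pi Q s)] for a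
    large multiple [Q] of [q], does this with [t = (1 / (2 Q), 0)]
    ([stretch_dense]): translating by half a period changes the sign of the
    vertical shear, so that the vertical shear and its inverse add up instead
    of cancelling, and since one period of the profile is shorter than the
    allowed error, each shear can be made to contribute any displacement in
    [-N, N] at the cost of a negligible motion.

    The estimate [rotation_conj_close] is made in the norm of a complex strip.
    It needs the entire extensions of the lifts of [h] and of its inverse to
    move the points of a strip by a bounded amount and to be uniformly
    continuous there ([commutes_Z2C_bounded], [commutes_Z2C_unif]).  By
    compactness this follows from their commutation with integer translations,
    which is known on the real plane only, and carries over to the complex one
    by the identity theorem: an entire function which vanishes on the real
    points vanishes ([entire_zero]).

    The identity theorem is proved with real variables.  If [u + i v] is
    complex differentiable, the forms [u dx - v dy] and [v dx + u dy] are
    closed, and the bisection argument of Goursat gives them primitives [U]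
    and [V] ([closed_form_primitive]).  The function [F = U + i V] is twice
    complex differentiable, so that [log |F|] is harmonic where it is finite
    and obeys the maximum principle by the second derivative test.  If [u] and
    [v] vanish on the real axis, one may take [F = 0] there, and comparing
    [log |F|] with large multiples of the harmonic function
    [(L - y) ^ 2 - x ^ 2] on a rectangle standing on the axis forces [F = 0]
    above the axis ([holo_zero_up]). *)

Set Implicit Arguments.
Unset Strict Implicit.
Unset Printing Implicit Defensive.

Import Order.TTheory GRing.Theory Num.Theory.
Import numFieldNormedType.Exports.

Local Open Scope classical_set_scope.
Local Open Scope ring_scope.
Local Open Scope quotient_scope.

Local Notation normc := ComplexField.Normc.normc.

(** * One-variable calculus *)

Lemma is_derive_of_eps (R : realType) (f : R -> R) (x l : R) :
  (forall e, 0 < e -> exists2 d, 0 < d &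
    forall h, `|h| < d -> `|f (x + h) - f x - l * h| <= e * `|h|) ->
  is_derive x 1 f l.
Proof.
move=> H.
have lim : h^-1 *: (f (h *: 1 + x) - f x) @[h --> (0 : R)^'] --> l.
  apply/cvgrPdistC_le => e e0; have [d d0 hd] := H e e0.
  near=> h.
  have h0 : h != 0 by near: h; exact: nbhs_dnbhs_neq.
  have hd' : `|h| < d by near: h; exact: dnbhs0_lt.
  have -> : h^-1 *: (f (h *: 1 + x) - f x) - l =
            h^-1 * (f (x + h) - f x - l * h).
    rewrite /GRing.scale /= mulr1 (addrC h) !mulrBr mulrCA mulVf// mulr1; ring.
  rewrite normrM normfV mulrC ler_pdivrMr ?normr_gt0//; exact: hd.
have df : derivable f x 1 by apply/cvg_ex; exists l.
by apply: DeriveDef => //; apply: cvg_lim.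
Unshelve. all: by end_near.
Qed.

Lemma is_derive_mvt (R : realType) (f df : R -> R) (a b : R) : a <= b ->
  (forall x, a <= x <= b -> is_derive x 1 f (df x)) ->
  exists2 c, a <= c <= b & f b - f a = df c * (b - a).
Proof.
move=> ab H; have [|||c ci e] := @MVT_segment R f df a b => //.
- by move=> x; rewrite in_itv/= => /andP[? ?]; apply: H; rewrite !ltW.
- apply: derivable_within_continuous => x; rewrite in_itv/= => xi.
  by have [] := H x xi.
- by exists c; rewrite ?in_itv/= in ci *.
Qed.

Lemma antiderivative_right (R : realType) (f : R -> R) : continuous f ->
  exists A : R -> R, forall x : R, -1 < x -> is_derive x 1 A (f x).
Proof.
move=> cf; exists (fun x =>
  \int[lebesgue_measure]_(t in [set` Interval (BLeft (-1)) (BRight x)]) f t)%R => x x1.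
have [||||d e] := @continuous_FTC1 R f (BLeft (-1)) x (x + 1).
- lra.
- apply: continuous_compact_integrable; first exact: segment_compact.
  by apply: continuous_subspaceT => y; exact: cf.
- rewrite lte_fin; exact: x1.
- exact: cf.
by rewrite derive1E in e; exact: DeriveDef d e.
Qed.

(** Lebesgue integration gives an antiderivative to the right of -1; the one to
    the left of 1 is obtained by reflection, and they are glued at 0. *)
Lemma antiderivative (R : realType) (f : R -> R) : continuous f ->
  exists A : R -> R, forall x : R, is_derive x 1 A (f x).
Proof.
move=> cf; have [B hB] := antiderivative_right cf.
have cg : continuous (fun x => - f (- x)).
  move=> x; apply: continuousN; apply: (@continuous_comp _ _ _ -%R f).
    exact: opp_continuous.
  exact: cf.
have [C0 hC0] := antiderivative_right cg.
pose C x := C0 (- x).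
have hC (x : R) : x < 1 -> is_derive x 1 C (f x).
  move=> x1; have d0 : is_derive (- x) 1 C0 (- f x).
    by rewrite -[in f x](opprK x); apply: hC0; lra.
  have d1 : is_derive x 1 (-%R : R -> R) (- 1) by exact: is_deriveNid.
  by have := is_derive1_comp d0 d1; rewrite mulrN1 opprK.
have BC (x : R) : -1 < x < 1 -> B x - B 0 = C x - C 0.
  move=> /andP[x1 x2]; pose g t := B t - C t.
  have hg (t : R) : -1 < t < 1 -> is_derive t 1 g 0.
    move=> /andP[t1 t2]; rewrite -(subrr (f t)).
    by apply: is_deriveB; [exact: hB|exact: hC].
  have : g x = g 0.
    have [x0|x0] := leP 0 x.
      have [|t ti|c _] := @is_derive_mvt R g (fun=> 0) 0 x; first by [].
        by apply: hg; lra.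
      by rewrite mul0r; lra.
    have [|t ti|c _] := @is_derive_mvt R g (fun=> 0) x 0; first by lra.
      by apply: hg; lra.
    by rewrite mul0r; lra.
  rewrite /g; lra.
(* [BC] gives the two halves a common formula around 0. *)
exists (fun x => if 0 < x then B x - B 0 else C x - C 0) => x.
have [x0|x0] := ltP 0 x.
  apply: (@near_eq_is_derive _ _ _ (fun y => B y - B 0)).
    near=> y; suff -> : 0 < y by [].
    near: y; exact: lt_nbhsr.
  rewrite -[f x]subr0; apply: is_deriveB; apply: hB; lra.
apply: (@near_eq_is_derive _ _ _ (fun y => C y - C 0)).
  near=> y; case: ifP => // y0.
  have y1 : y < 1 by near: y; apply: lt_nbhsl; lra.
  rewrite -BC//; lra.
rewrite -[f x]subr0; apply: is_deriveB; apply: hC; lra.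
Unshelve. all: by end_near.
Qed.

(** * Goursat's theorem for closed forms in the plane *)

(** Functions of two real variables are curried, so that their restrictions to
    horizontal and vertical lines are functions of one variable. *)
Definition has_grad (R : realType) (P : R -> R -> R) (x y p1 p2 : R) : Prop :=
  forall e, 0 < e -> exists2 d, 0 < d & forall h k, `|h| < d -> `|k| < d ->
    `|P (x + h) (y + k) - P x y - p1 * h - p2 * k| <= e * (`|h| + `|k|).

Lemma has_grad_dx (R : realType) (P : R -> R -> R) x y p1 p2 :
  has_grad P x y p1 p2 -> is_derive x 1 (P^~ y) p1.
Proof.
move=> H; apply: is_derive_of_eps => e /H[d d0 hd]; exists d => // h hd'.
have := hd h 0 hd'; rewrite normr0 => /(_ d0).
by rewrite !addr0 mulr0 subr0.
Qed.

Lemma has_grad_dy (R : realType) (P : R -> R -> R) x y p1 p2 :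
  has_grad P x y p1 p2 -> is_derive y 1 (P x) p2.
Proof.
move=> H; apply: is_derive_of_eps => e /H[d d0 hd]; exists d => // h hd'.
have := hd 0 h; rewrite normr0 => /(_ d0 hd').
by rewrite !addr0 add0r mulr0 subr0.
Qed.

Lemma derive_continuous (R : realType) (f df : R -> R) :
  (forall x : R, is_derive x 1 f (df x)) -> continuous f.
Proof.
move=> H x; apply: differentiable_continuous; apply/derivable1_diffP.
by have [] := H x.
Qed.

(** The coefficients are differentiable at each point, with equal cross
    derivatives, but these derivatives may fail to be continuous: this is why
    the existence of primitives needs the argument of Goursat. *)
Definition closed_form (R : realType) (P Q : R -> R -> R) : Prop :=
  forall x y, exists p1 r q2, has_grad P x y p1 r /\ has_grad Q x y r q2.

Lemma nested_intervals (R : realType) (a b : nat -> R) :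
  (forall n, a n <= a n.+1) -> (forall n, b n.+1 <= b n) ->
  (forall n, a n <= b n) -> exists p, forall n, a n <= p <= b n.
Proof.
move=> a_nd b_ni ab.
have hnd : {homo a : m n / (m <= n)%N >-> m <= n} 
  by apply: homo_leq; [exact: lexx|move=> y x z; exact: le_trans|exact: a_nd].
have hni m n : (m <= n)%N -> b n <= b m.
  elim: n => [|n IH]; first by rewrite leqn0 => /eqP->.
  by rewrite leq_eqVlt => /orP[/eqP->//|/IH]; exact: le_trans.
have ub n : ubound (range a) (b n).
  move=> _ [m _ <-]; have [mn|/ltnW nm] := leqP m n.
    exact: le_trans (hnd _ _ mn) (ab n).
  exact: le_trans (ab m) (hni _ _ nm).
have hs : has_sup (range a) by split; [exists (a 0%N), 0%N|exists (b 0%N); exact: ub].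
exists (sup (range a)) => n; apply/andP; split.
  by apply: sup_upper_bound => //; exists n.
by apply: ge_sup => //; exists (a 0%N), 0%N.
Qed.

Section goursat.
Variables (R : realType) (P Q : R -> R -> R).
Hypothesis PQ : closed_form P Q.
Variables A B : R -> R -> R.
Hypothesis hA : forall y x : R, is_derive x 1 (A y) (P x y).
Hypothesis hB : forall x y : R, is_derive y 1 (B x) (Q x y).

(** The integral of the form [P dx + Q dy] along the boundary of the rectangle
    with corner [(a, c)] and sides [w] and [h].  Being written with
    antiderivatives of [P] along rows and of [Q] along columns, it is additive
    under subdivision by mere telescoping, and makes sense for negative sides. *)
Definition circulation a c w h := A c (a + w) - A c a
  + (B (a + w) (c + h) - B (a + w) c)
  - (A (c + h) (a + w) - A (c + h) a) - (B a (c + h) - B a c).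

(** By the mean value theorem the circulation equals [(P s c - P s (c + h)) w +
    (Q (a + w) t - Q a t) h] for some [s] and [t].  The first-order terms of the
    two differences cancel because the cross derivatives agree. *)
Lemma circulation_small p q e : 0 < e -> exists2 d, 0 < d &
  forall a c w h, a <= p <= a + w -> c <= q <= c + h -> w < d -> h < d ->
  `|circulation a c w h| <= e * (w + h) ^+ 2.
Proof.
move=> e0; have [p1 [r [q2 [gP gQ]]]] := PQ p q.
have e20 : 0 < e / 2 by lra.
have [d1 d10 H1] := gP _ e20; have [d2 d20 H2] := gQ _ e20.
exists (Num.min d1 d2); first by rewrite lt_min d10.
move=> a c w h /andP[ap pa] /andP[cq qc]; rewrite !lt_min => /andP[w1 w2] /andP[h1 h2].
have w0 : 0 <= w by lra.
have h0 : 0 <= h by lra.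
have eP s t : a <= s <= a + w -> c <= t <= c + h ->
    `|P s t - P p q - p1 * (s - p) - r * (t - q)| <= e / 2 * (w + h).
  move=> sw th; have := H1 (s - p) (t - q).
  rewrite ![_ + (_ - _)]addrC !subrK => /(_ _ _)/le_trans; apply.
  - by rewrite ltr_norml; lra.
  - by rewrite ltr_norml; lra.
  - apply: ler_wpM2l; first lra.
    by apply: lerD; rewrite ler_norml; lra.
have eQ s t : a <= s <= a + w -> c <= t <= c + h ->
    `|Q s t - Q p q - r * (s - p) - q2 * (t - q)| <= e / 2 * (w + h).
  move=> sw th; have := H2 (s - p) (t - q).
  rewrite ![_ + (_ - _)]addrC !subrK => /(_ _ _)/le_trans; apply.
  - by rewrite ltr_norml; lra.
  - by rewrite ltr_norml; lra.
  - apply: ler_wpM2l; first lra.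
    by apply: lerD; rewrite ler_norml; lra.
have [|s si es] := @is_derive_mvt R (A c - A (c + h))
  (fun s => P s c - P s (c + h)) a (a + w).
- lra.
have [|t ti et] := @is_derive_mvt R (B (a + w) - B a)
  (fun s => Q (a + w) s - Q a s) c (c + h).
- lra.
have -> : circulation a c w h = (P s c - P s (c + h)) * w + (Q (a + w) t - Q a t) * h.
  move: es et; rewrite /circulation !fctE => es et.
  rewrite [a + w - a]addrAC subrr add0r in es.
  rewrite [c + h - c]addrAC subrr add0r in et.
  rewrite -es -et; ring.
have /eP/(_ (_ : c <= c <= c + h)) E1 := si.
have /eP/(_ (_ : c <= c + h <= c + h)) E2 := si.
have /eQ/(_ ti) E3 : a <= a <= a + w by lra.
have /eQ/(_ ti) E4 : a <= a + w <= a + w by lra.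
have {}E1 := E1 ltac:(lra). have {}E2 := E2 ltac:(lra).
move: E1 E2 E3 E4.
set x1 := (X in `|X|); set x2 := (X in _ -> `|X| <= _ -> _).
set x3 := (X in _ -> _ -> `|X| <= _ -> _); set x4 := (X in _ -> _ -> _ -> `|X| <= _ -> _).
move=> E1 E2 E3 E4.
have -> : (P s c - P s (c + h)) * w + (Q (a + w) t - Q a t) * h =
  (x1 - x2) * w + (x4 - x3) * h by rewrite /x1 /x2 /x3 /x4; ring.
apply: (@le_trans _ _ ((e * (w + h)) * w + (e * (w + h)) * h)); last by rewrite expr2; lra.
apply: le_trans (ler_normD _ _) _; rewrite !normrM (ger0_norm w0) (ger0_norm h0).
by apply: lerD; apply: ler_wpM2r => //; apply: le_trans (ler_normB _ _) _; lra.
Qed.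

Let bad e a c w h := e * (w + h) ^+ 2 < `|circulation a c w h|.

Let bad_split e a c w h : bad e a c w h -> let w' := w / 2 in let h' := h / 2 in
  [|| bad e a c w' h', bad e (a + w') c w' h', bad e a (c + h') w' h' |
      bad e (a + w') (c + h') w' h'].
Proof.
rewrite /bad => H /=; apply: contraLR H; rewrite !negb_or -!leNgt => /and4P[].
move=> H1 H2 H3 H4.
have -> : circulation a c w h = circulation a c (w/2) (h/2)
   + circulation (a + w/2) c (w/2) (h/2) + circulation a (c + h/2) (w/2) (h/2)
   + circulation (a + w/2) (c + h/2) (w/2) (h/2).
  rewrite /circulation -!(addrA _ (_ / 2) (_ / 2)) -!splitr; ring.
have tri (x y z t : R) : `|x + y + z + t| <= `|x| + `|y| + `|z| + `|t|.
  have := ler_normD (x + y + z) t; have := ler_normD (x + y) z.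
  have := ler_normD x y; lra.
apply: le_trans (tri _ _ _ _) _.
have -> : (w + h)^+2 = 4 * (w/2 + h/2)^+2 by field.
rewrite mulrCA; move: H1 H2 H3 H4; set t := e * _; lra.
Qed.

(** If the circulation were nonzero, repeated bisection would give rectangles
    shrinking to a point whose circulation stays above a fixed multiple of the
    square of their size, against [circulation_small]. *)
Lemma goursat_ge0 a c w h : 0 <= w -> 0 <= h -> circulation a c w h = 0.
Proof.
move=> w0 h0; apply/eqP/negPn/negP => C0.
(* The added 1 keeps the denominator positive for a degenerate rectangle. *)
pose e := `|circulation a c w h| / (2 * ((w + h) ^+ 2 + 1)).
have S0 : 0 <= (w + h)^+2 by exact: sqr_ge0.
have e0 : 0 < e by rewrite divr_gt0 ?normr_gt0//; lra.
have bad0 : bad e a c w h.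
  rewrite /bad /e -mulrA [X in _ * X]mulrC mulrA ltr_pdivrMr; last lra.
  rewrite ltr_pM2l ?normr_gt0//; lra.
pose W n := w / 2 ^+ n; pose H n := h / 2 ^+ n.
have WS n : W n.+1 = W n / 2 by rewrite /W exprSr invfM mulrA.
have HS n : H n.+1 = H n / 2 by rewrite /H exprSr invfM mulrA.
have W0 n : 0 <= W n by rewrite divr_ge0// exprn_ge0.
have H0 n : 0 <= H n by rewrite divr_ge0// exprn_ge0.
pose step n (s : R * R) :=
  if bad e s.1 s.2 (W n.+1) (H n.+1) then s else
  if bad e (s.1 + W n.+1) s.2 (W n.+1) (H n.+1) then (s.1 + W n.+1, s.2) else
  if bad e s.1 (s.2 + H n.+1) (W n.+1) (H n.+1) then (s.1, s.2 + H n.+1) else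
  (s.1 + W n.+1, s.2 + H n.+1).
pose s := fix s n := if n is n'.+1 then step n' (s n') else (a, c).
have sbad n : bad e (s n).1 (s n).2 (W n) (H n).
  elim: n => [|n IH]; first by rewrite /= /W /H expr0 !divr1.
  rewrite [s _]/= /step; case: ifPn => // n1; case: ifPn => // n2; case: ifPn => // n3.
  move: (bad_split IH); rewrite /= -WS -HS.
  by rewrite (negbTE n1) (negbTE n2) (negbTE n3).
have s1 n : (s n).1 <= (s n.+1).1 <= (s n).1 + W n.+1.
  have := W0 n.+1; rewrite [s n.+1]/= /step => w1.
  by case: ifP => _; [|case: ifP => _; [|case: ifP => _]] => /=; lra.
have s2 n : (s n).2 <= (s n.+1).2 <= (s n).2 + H n.+1.
  have := H0 n.+1; rewrite [s n.+1]/= /step => w1.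
  by case: ifP => _; [|case: ifP => _; [|case: ifP => _]] => /=; lra.
have [n|n|n|p hp] := @nested_intervals R (fun n => (s n).1) (fun n => (s n).1 + W n).
- by have /andP[] := s1 n.
- by have /andP[_] := s1 n; have := WS n; lra.
- by have := W0 n; lra.
have [n|n|n|q hq] := @nested_intervals R (fun n => (s n).2) (fun n => (s n).2 + H n).
- by have /andP[] := s2 n.
- by have /andP[_] := s2 n; have := HS n; lra.
- by have := H0 n; lra.
have [d d0 hd] := circulation_small p q e0.
have [n wn] : exists n, W n + H n < d.
  pose n := Num.bound ((w + h) / d); exists n.
  rewrite /W /H -mulrDl ltr_pdivrMr ?exprn_gt0// mulrC -ltr_pdivrMr//.
  have := archi_boundP (divr_ge0 (addr_ge0 w0 h0) (ltW d0)).
  move=> /lt_trans; apply; rewrite -natrX ltr_nat -/n; exact: ltn_expl.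
have wd : W n < d by have := H0 n; lra.
have hd' : H n < d by have := W0 n; lra.
have := hd _ _ _ _ (hp n) (hq n) wd hd'.
by rewrite leNgt => /negP; apply; exact: sbad.
Qed.

Lemma goursat a c w h : circulation a c w h = 0.
Proof.
have flipw a' c' w' h' : circulation a' c' w' h' = - circulation (a' + w') c' (- w') h'.
  by rewrite /circulation addrK; ring.
have fliph a' c' w' h' : circulation a' c' w' h' = - circulation a' (c' + h') w' (- h').
  by rewrite /circulation addrK; ring.
have hw a' c' w' h' : 0 <= h' -> circulation a' c' w' h' = 0.
  move=> h0; have [w0|w0] := leP 0 w'; first exact: goursat_ge0.
  by rewrite flipw goursat_ge0 ?oppr0// oppr_ge0 ltW.
have [h0|h0] := leP 0 h; first exact: hw.
by rewrite fliph hw ?oppr0// oppr_ge0 ltW.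
Qed.

End goursat.

Lemma closed_form_primitive (R : realType) (P Q : R -> R -> R) : closed_form P Q ->
  exists U : R -> R -> R, forall x y : R,
    is_derive x 1 (U^~ y) (P x y) /\ is_derive y 1 (U x) (Q x y).
Proof.
move=> PQ.
have cP y : continuous (P^~ y).
  apply: (@derive_continuous R _ (fun x => 'D_1 (P^~ y) x)) => x.
  have [p1 [r [q2 [gP _]]]] := PQ x y.
  by apply: derivableP; have [] := has_grad_dx gP.
have cQ x : continuous (Q x).
  apply: (@derive_continuous R _ (fun y => 'D_1 (Q x) y)) => y.
  have [p1 [r [q2 [_ gQ]]]] := PQ x y.
  by apply: derivableP; have [] := has_grad_dy gQ.
have [A hA] := choice (fun y => antiderivative (cP y)).
have [B hB] := choice (fun x => antiderivative (cQ x)).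
(* Integration from the origin first along the horizontal axis, then upwards;
   [UE] is the other way round, by Goursat. *)
pose U x y := A 0 x - A 0 0 + (B x y - B x 0).
have UE x y : U x y = B 0 y - B 0 0 + (A y x - A y 0).
  have := goursat PQ hA hB 0 0 x y; rewrite /circulation !add0r /U; lra.
exists U => x y; split.
  have -> : U^~ y = cst (B 0 y - B 0 0 - A y 0) + A y.
    by apply/funext => t; rewrite UE fctE /=; ring.
  rewrite -[P x y]add0r; exact: is_deriveD.
have -> : U x = cst (A 0 x - A 0 0 - B x 0) + B x.
  by apply/funext => t; rewrite /U fctE /=; ring.
rewrite -[Q x y]add0r; exact: is_deriveD.
Qed.

(** * Unique continuation from the real axis *)

Lemma is_derive_eps (R : realType) (f : R -> R) (x l : R) : is_derive x 1 f l ->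
  forall e, 0 < e -> exists2 d, 0 < d &
    forall h, `|h| < d -> `|f (x + h) - f x - l * h| <= e * `|h|.
Proof.
move=> [df el] e e0.
have lim : h^-1 *: (f (h *: 1 + x) - f x) @[h --> (0 : R)^'] --> l by rewrite -el.
move/cvgrPdistC_le : lim => /(_ e e0) /nbhs_ballP[d /= d0 hd].
exists d => // h hd'; have [->|h0] := eqVneq h 0.
  by rewrite addr0 subrr mulr0 subr0 !normr0 mulr0.
have := hd h; rewrite /ball /= sub0r normrN => /(_ hd' h0).
have -> : h^-1 *: (f (h *: 1 + x) - f x) - l = h^-1 * (f (x + h) - f x - l * h).
  rewrite /GRing.scale /= mulr1 (addrC h) !mulrBr mulrCA mulVf// mulr1; ring.
by rewrite normrM normfV mulrC ler_pdivrMr ?normr_gt0.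
Qed.

Lemma is_derive_uniq (R : realType) (f : R -> R) (x l m : R) :
  is_derive x 1 f l -> is_derive x 1 f m -> l = m.
Proof. by move=> [_ <-] [_ <-]. Qed.

Section derive_rules.
Variables (R : realType) (f g : R -> R) (x a b : R).

Lemma der_cst (c : R) : is_derive x 1 (fun=> c) 0.
Proof. exact: is_derive_cst. Qed.

Lemma der_id : is_derive x 1 (fun t : R => t) 1.
Proof. exact: is_derive_id. Qed.

Lemma derD : is_derive x 1 f a -> is_derive x 1 g b ->
  is_derive x 1 (fun t => f t + g t) (a + b).
Proof. exact: is_deriveD. Qed.

Lemma derN : is_derive x 1 f a -> is_derive x 1 (fun t => - f t) (- a).
Proof. exact: is_deriveN. Qed.

Lemma derM : is_derive x 1 f a -> is_derive x 1 g b ->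
  is_derive x 1 (fun t => f t * g t) (f x * b + g x * a).
Proof. by move=> hf hg; have := is_deriveM hf hg. Qed.

Lemma der_sqr : is_derive x 1 f a -> is_derive x 1 (fun t => f t ^+ 2) (2 * (f x * a)).
Proof.
move=> hf; under eq_fun do rewrite expr2.
by have -> : 2 * (f x * a) = f x * a + f x * a; [ring|exact: (is_deriveM hf hf)].
Qed.

Lemma der_exp : is_derive x 1 f a -> is_derive x 1 (fun t => expR (f t)) (expR (f x) * a).
Proof. by move=> hf; have := is_derive1_comp (is_derive_expR (f x)) hf. Qed.
End derive_rules.

Ltac der := lazymatch goal with
  | |- is_derive _ _ (fun t => t) _ => eapply der_id
  | |- is_derive _ _ (fun t => @?f t + @?g t) _ => eapply (@derD _ f g); [der|der]
  | |- is_derive _ _ (fun t => - (@?f t)) _ => eapply (@derN _ f); der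
  | |- is_derive _ _ (fun t => @?f t * @?g t) _ => eapply (@derM _ f g); [der|der]
  | |- is_derive _ _ (fun t => @?f t ^+ 2) _ => eapply (@der_sqr _ f); der
  | |- is_derive _ _ (fun t => expR (@?f t)) _ => eapply (@der_exp _ f); der
  | |- _ => first [eassumption | eapply der_cst]
  end.

Ltac der_eq := eapply is_derive_eq; [der|].

(** The derivative of [f] is given as a product with a positive factor [E]: in
    the application [f] is a function times an exponential, and only the other
    factor [m] of the derivative has to be differentiated again. *)
Lemma second_order_max (R : realType) (f m E : R -> R) (a b c m' : R) :
  (forall t : R, is_derive t 1 f (m t * E t)) -> (forall t, 0 < E t) ->
  is_derive c 1 m m' -> a < c < b -> (forall t, a < t < b -> f t <= f c) ->
  m c = 0 /\ m' <= 0.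
Proof.
move=> hf E0 hm /andP[ac cb] fmax.
have mc : m c = 0.
  have h0 : is_derive c 1 f 0.
    have dt t : t \in `]a, b[ -> derivable f t 1 by move=> _; have [] := hf t.
    apply: (derive1_at_max _ dt) => [||t]; rewrite ?in_itv /= ?ac//.
      by rewrite ltW// (lt_trans ac).
    exact: fmax.
  have /eqP := is_derive_uniq (hf c) h0.
  by rewrite mulf_eq0 (gt_eqF (E0 c)) orbF => /eqP.
split=> //; rewrite leNgt; apply/negP => m0.
have m20 : 0 < m' / 2 by lra.
have [d d0 hd] := is_derive_eps hm m20.
pose t := Num.min (c + d / 2) ((c + b) / 2).
have ct : c < t by rewrite lt_min; lra.
have td : t - c < d by rewrite ltrBlDl gt_min; apply/orP; left; lra.
have tb : t < b by rewrite gt_min; apply/orP; right; lra.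
have [|x xi e] := @MVT R f (fun t => m t * E t) c t ct _ _.
- by apply: derivable_within_continuous => x _; have [] := hf x.
move: xi; rewrite in_itv /= => /andP[cx xt].
have : f t <= f c by apply: fmax; rewrite tb andbT (lt_trans ac).
apply/negP; rewrite -ltNge -subr_gt0 e; apply: mulr_gt0; last lra.
apply: mulr_gt0 => //; have := hd (x - c).
rewrite ger0_norm; last lra.
rewrite [c + _]addrC subrK mc subr0 => /(_ ltac:(lra)).
have : 0 < m' / 2 * (x - c) by apply: mulr_gt0; lra.
rewrite ler_norml => ? /andP[+ _]; lra.
Qed.

Definition cont2 (R : realType) (P : R -> R -> R) x y :=
  forall e, 0 < e -> exists2 d, 0 < d & forall h k, `|h| < d -> `|k| < d ->
    `|P (x + h) (y + k) - P x y| <= e.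

Lemma cont2P (R : realType) (P : R -> R -> R) x y :
  cont2 P x y <-> {for (x, y), continuous (fun z : R * R => P z.1 z.2)}.
Proof.
split=> H.
  apply/cvgrPdistC_le => e /H[d d0 hd] /=.
  apply/(@nbhs_ballP R (R * R)%type (x, y)); exists d => //= -[s t] [/= b1 b2].
  have := hd (s - x) (t - y).
  by rewrite ![_ + (_ - _)]addrC !subrK; apply; rewrite distrC.
move=> e e0; move/cvgrPdistC_le : H => /(_ e e0) /nbhs_ballP[d /= d0 hd].
exists d => // h k h0 k0; have := hd (x + h, y + k); apply.
by split; rewrite /ball /= opprD addrA subrr sub0r normrN.
Qed.

Lemma has_grad_cont2 (R : realType) (P : R -> R -> R) x y p1 p2 :
  has_grad P x y p1 p2 -> cont2 P x y.
Proof.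
move=> H e e0; have [d d0 hd] := H 1 ltr01.
pose M := 1 + `|p1| + 1 + `|p2|.
have M0 : 0 < M by rewrite /M; have := normr_ge0 p1; have := normr_ge0 p2; lra.
exists (Num.min d (e / M)); first by rewrite lt_min d0 divr_gt0.
move=> h k; rewrite !lt_min => /andP[h1 h2] /andP[k1 k2].
have := hd h k h1 k1; rewrite mul1r => E.
have -> : P (x + h) (y + k) - P x y =
  (P (x + h) (y + k) - P x y - p1 * h - p2 * k) + (p1 * h + p2 * k) by ring.
apply: le_trans (ler_normD _ _) _.
have E2 : `|p1 * h + p2 * k| <= `|p1| * `|h| + `|p2| * `|k|.
  by rewrite -!normrM ler_normD.
apply: (@le_trans _ _ ((1 + `|p1|) * `|h| + (1 + `|p2|) * `|k|)); first by lra.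
apply: (@le_trans _ _ ((1 + `|p1|) * (e / M) + (1 + `|p2|) * (e / M))).
  by apply: lerD; apply: ler_wpM2l; rewrite ?ltW// ltr_pwDl.
by rewrite -mulrDl addrA -/M mulrC divfK ?gt_eqF.
Qed.

(** Each increment along a coordinate is controlled by the mean value theorem. *)
Lemma C1_has_grad (R : realType) (U P Q : R -> R -> R) x y :
  (forall x y : R, is_derive x 1 (U^~ y) (P x y)) ->
  (forall x y : R, is_derive y 1 (U x) (Q x y)) ->
  cont2 P x y -> cont2 Q x y -> has_grad U x y (P x y) (Q x y).
Proof.
move=> hP hQ cP cQ e e0; have [d1 d10 H1] := cP e e0; have [d2 d20 H2] := cQ e e0.
exists (Num.min d1 d2); first by rewrite lt_min d10.
move=> h k; rewrite !lt_min => /andP[h1 h2] /andP[k1 k2].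
have mvt (f df : R -> R) (z w : R) : (forall x : R, is_derive x 1 f (df x)) ->
    exists2 c, `|c| <= `|w| & f (z + w) - f z = df (z + c) * w.
  move=> hf; have [w0|w0] := leP 0 w.
    have [|c ci e1] := @is_derive_mvt R f df z (z + w); first lra.
    exists (c - z); first by rewrite ger0_norm; [rewrite ger0_norm|]; lra.
    by rewrite e1 [z + (_ - _)]addrC subrK [z + w]addrC addrK.
  have [|c ci e1] := @is_derive_mvt R f df (z + w) z; first lra.
  exists (c - z); first by rewrite ler0_norm; [rewrite ltr0_norm|]; lra.
  rewrite [z + (_ - _)]addrC subrK; move: e1.
  have -> : z - (z + w) = - w by ring.
  by rewrite mulrN -opprB => /oppr_inj.
have [c ch e1] := mvt (U^~ (y + k)) (P^~ (y + k)) x h (fun x => hP x _).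
have [c' ck e2] := mvt (U x) (Q x) y k (hQ x).
have -> : U (x + h) (y + k) - U x y - P x y * h - Q x y * k =
   (P (x + c) (y + k) - P x y) * h + (Q (x + 0) (y + c') - Q x y) * k.
  by rewrite !mulrBl addr0 -e1 -e2; ring.
apply: le_trans (ler_normD _ _) _; rewrite !normrM mulrDr.
apply: lerD; apply: ler_wpM2r => //.
  by apply: H1 => //; apply: le_lt_trans h1.
by apply: H2 => //; rewrite ?normr0//; apply: le_lt_trans k2.
Qed.

(** The Cauchy-Riemann equations: [u + i v] has the complex derivative
    [p - i r] at [(x, y)]. *)
Definition holo (R : realType) (u v : R -> R -> R) : Prop :=
  forall x y, exists p r, has_grad u x y p r /\ has_grad v x y (- r) p.

Lemma has_gradN (R : realType) (u : R -> R -> R) x y p r :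
  has_grad u x y p r -> has_grad (fun x y => - u x y) x y (- p) (- r).
Proof.
move=> H e e0; have [d d0 hd] := H e e0; exists d => // h k h0 k0.
have := hd h k h0 k0; rewrite -normrN; congr (`|_| <= _); ring.
Qed.

Lemma continuous_sqr (R : realType) (T : topologicalType) (f : T -> R) (z : T) :
  {for z, continuous f} -> {for z, continuous (fun z => f z ^+ 2)}.
Proof.
move=> cf; have -> : (fun z => f z ^+ 2) = (fun z => f z * f z).
  by apply/funext => t; rewrite expr2.
exact: continuousM.
Qed.

Lemma continuous_add (R : realType) (T : topologicalType) (f g : T -> R) (z : T) :
  {for z, continuous f} -> {for z, continuous g} -> {for z, continuous (fun z => f z + g z)}.
Proof. by move=> cf cg; exact: cvgD. Qed.

Lemma continuous_mul (R : realType) (T : topologicalType) (f g : T -> R) (z : T) :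
  {for z, continuous f} -> {for z, continuous g} -> {for z, continuous (fun z => f z * g z)}.
Proof. by move=> cf cg; exact: cvgM. Qed.

Section unique_continuation.
Variables (R : realType) (u v : R -> R -> R).
Hypothesis uv : holo u v.
Hypothesis u0 : forall x, u x 0 = 0.
Hypothesis v0 : forall x, v x 0 = 0.

Let primitive : exists U V : R -> R -> R, [/\ (forall x, U x 0 = 0 /\ V x 0 = 0),
  (forall x y : R, is_derive x 1 (U^~ y) (u x y)),
  (forall x y : R, is_derive y 1 (U x) (- v x y)),
  (forall x y : R, is_derive x 1 (V^~ y) (v x y)) &
  (forall x y : R, is_derive y 1 (V x) (u x y))].
Proof.
have c1 : closed_form u (fun x y => - v x y).
  move=> x y; have [p [r [gu gv]]] := uv x y; exists p, r, (- p); split=> //.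
  by rewrite -[r in has_grad _ _ _ r _]opprK; exact: has_gradN.
have c2 : closed_form v u.
  by move=> x y; have [p [r [gu gv]]] := uv x y; exists (- r), p, r.
have [U hU] := closed_form_primitive c1.
have [V hV] := closed_form_primitive c2.
have dB (f : R -> R) (c x l : R) : is_derive x 1 f l -> is_derive x 1 (fun t => f t - c) l.
  move=> h; have -> : (fun t => f t - c) = f - cst c by apply/funext.
  by rewrite -[l]subr0; exact: is_deriveB.
exists (fun x y => U x y - U 0 0), (fun x y => V x y - V 0 0); split=> [x|x y|x y|x y|x y].
- split; apply/eqP; rewrite subr_eq0; apply/eqP.
    apply: (@is_derive_0_is_cst R (U^~ 0)) => t.
    by have [+ _] := hU t 0; rewrite u0.
  apply: (@is_derive_0_is_cst R (V^~ 0)) => t.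
  by have [+ _] := hV t 0; rewrite v0.
- by apply: dB; have [] := hU x y.
- by apply: dB; have [] := hU x y.
- by apply: dB; have [] := hV x y.
- by apply: dB; have [] := hV x y.
Qed.

(** With [F = U + i V] a primitive of [u + i v] that vanishes on the real axis
    and [D = |F| ^ 2], the maximum of [D exp (s ((L - y) ^ 2 - x ^ 2) + x ^ 2)] on
    the rectangle [[-L, L] x [0, L]] is not attained inside, and on the boundary
    it is bounded independently of [s].  Letting [s] tend to infinity gives
    [D = 0] at the points [(0, y)]. *)
Lemma holo_zero_up (y : R) : 0 < y -> u 0 y = 0 /\ v 0 y = 0.
Proof.
move=> y0; have [U [V [UV0 Ux Uy Vx Vy]]] := primitive.
have cu x' y' : cont2 u x' y'.
  by have [p [r [gu _]]] := uv x' y'; exact: has_grad_cont2 gu.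
have cv x' y' : cont2 v x' y'.
  by have [p [r [_ gv]]] := uv x' y'; exact: has_grad_cont2 gv.
have cNv x' y' : cont2 (fun x y => - v x y) x' y'.
  by have [p [r [_ gv]]] := uv x' y'; exact: has_grad_cont2 (has_gradN gv).
have cU : continuous (fun z : R * R => U z.1 z.2).
  move=> [x' y']; apply/cont2P; apply: has_grad_cont2.
  exact: C1_has_grad Ux Uy (cu _ _) (cNv _ _).
have cV : continuous (fun z : R * R => V z.1 z.2).
  move=> [x' y']; apply/cont2P; apply: has_grad_cont2.
  exact: C1_has_grad Vx Vy (cv _ _) (cu _ _).
pose D x y := U x y ^+ 2 + V x y ^+ 2.
have D0 x y' : 0 <= D x y' by rewrite addr_ge0 ?sqr_ge0.
have cD : continuous (fun z : R * R => D z.1 z.2).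
  rewrite /D => z.
  apply: (@continuous_add _ _ (fun z => U z.1 z.2 ^+ 2) (fun z => V z.1 z.2 ^+ 2)).
    exact: continuous_sqr (cU z).
  exact: continuous_sqr (cV z).
have [L yL] : exists L, y < L by exists (y + 1); lra.
have L0 : 0 < L by lra.
pose K := `[- L, L]%classic `*` `[0, L]%classic.
have cK : compact K by apply: compact_setX; exact: segment_compact.
have K0 : K !=set0 by exists (0, 0); split; rewrite /= in_itv /=; lra.
have KP x' y' : (x', y') \in K = ((- L <= x' <= L) && (0 <= y' <= L)).
  apply/idP/andP => [/set_mem[]|[h1 h2]]; rewrite /= ?in_itv//.
  by apply/mem_set; split; rewrite /= in_itv.
have [[mx my] _ Mmax] := compact_EVT_max K0 cK (continuous_subspaceT cD).
pose M := D mx my.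
(* The first term of the weight is harmonic, at most 0 on the vertical sides
   and on the top of [K], and positive for [s > 0] at the points [(0, y)] with
   [y < L]; the term [x ^ 2] makes the weight strictly subharmonic,
   so that [W s] has no positive maximum inside [K]. *)
pose th (s x y : R) := s * ((L - y) ^+ 2 - x ^+ 2) + x ^+ 2.
pose W (s x y : R) := D x y * expR (th s x y).
have Wle s : 0 <= s -> forall x' y', (x', y') \in K -> W s x' y' <= M * expR (L ^+ 2).
  move=> s0 x' y' K'.
  have cW : continuous (fun z : R * R => W s z.1 z.2).
    move=> z; apply: (@continuous_mul _ _ (fun z => D z.1 z.2) (fun z => expR (th s z.1 z.2))).
      exact: cD.
    apply: (@continuous_comp _ _ _ (fun z => th s z.1 z.2) expR); last exact: continuous_expR.
    have cx : {for z, continuous (fun z : R * R => z.1 ^+ 2)}.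
      by apply: continuous_sqr; exact: cvg_fst.
    have cy : {for z, continuous (fun z : R * R => (L - z.2) ^+ 2)}.
      by apply: continuous_sqr; apply: cvgB; [exact: cvg_cst|exact: cvg_snd].
    rewrite /th; apply: (@continuous_add R (R * R)%type
      (fun z : R * R => s * ((L - z.2) ^+ 2 - z.1 ^+ 2)) (fun z : R * R => z.1 ^+ 2) z) => //.
    apply: (@continuous_mul R (R * R)%type (fun=> s)
      (fun z : R * R => (L - z.2) ^+ 2 - z.1 ^+ 2)); first exact: cvg_cst.
    exact: cvgB.
  have [[a b] abK Wmax] := compact_EVT_max K0 cK (continuous_subspaceT cW).
  apply: le_trans (Wmax _ K') _ => /=.
  have DM : D a b <= M by exact: Mmax _ abK.
  have dth : th s a b <= L ^+ 2 -> W s a b <= M * expR (L ^+ 2).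
    by move=> h; apply: ler_pM; rewrite ?expR_ge0// ler_expR.
  move: (abK); rewrite KP => /andP[/andP[a1 a2] /andP[b1 b2]].
  have bL : (L - b) ^+ 2 <= L ^+ 2.
    rewrite -subr_ge0; have -> : L ^+ 2 - (L - b) ^+ 2 = b * (2 * L - b) by ring.
    by apply: mulr_ge0; lra.
  have aL : a ^+ 2 <= L ^+ 2.
    rewrite -subr_ge0; have -> : L ^+ 2 - a ^+ 2 = (L - a) * (L + a) by ring.
    by apply: mulr_ge0; lra.
  have [aLe|aLn] := eqVneq (a ^+ 2) (L ^+ 2).
    apply: dth; rewrite /th aLe.
    have : 0 <= s * (L ^+ 2 - (L - b) ^+ 2) by rewrite mulr_ge0 // subr_ge0.
    lra.
  have aL' : - L < a < L.
    rewrite !lt_neqAle a1 a2 !andbT; apply/andP; split; apply: contra aLn.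
      by move/eqP <-; rewrite sqrrN.
    by move/eqP ->.
  have [beL|bLn] := eqVneq b L.
    apply: dth; rewrite /th beL subrr expr0n /= add0r.
    have : 0 <= s * a ^+ 2 by rewrite mulr_ge0 // sqr_ge0.
    lra.
  have [b0|b0] := eqVneq b 0.
    have -> : W s a b = 0 by rewrite /W /D b0 !(UV0 a).1 (UV0 a).2 !expr0n addr0 mul0r.
    by rewrite mulr_ge0 ?expR_ge0 // (le_trans _ DM).
  have b' : 0 < b < L by rewrite !lt_neqAle b1 b2 bLn [0 == b]eq_sym b0.
  have [Dz|Dn] := eqVneq (D a b) 0.
    by rewrite /W Dz mul0r mulr_ge0 ?expR_ge0 // (le_trans _ DM).
  have Dp : 0 < D a b by rewrite lt_neqAle eq_sym Dn D0.
  exfalso.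
  have [p [r [gu gv]]] := uv a b.
  pose m1 x := 2 * (U x b * u x b + V x b * v x b) + D x b * (2 * x - s * (2 * x)).
  pose m2 y := 2 * (V a y * u a y - U a y * v a y) + D a y * (- (s * (2 * (L - y)))).
  have [z1 z2] : m1 a = 0 /\ 2 * (u a b ^+2 + v a b ^+ 2 + U a b * p - V a b * r)
     + 2 * (U a b * u a b + V a b * v a b) * (2 * a - s * (2 * a)) + D a b * (2 - s * 2) <= 0.
    apply: (@second_order_max R (fun x => W s x b) m1 (fun x => expR (th s x b)) (- L) L).
    - move=> t; have h1 := Ux t b; have h2 := Vx t b; rewrite /W /D /th.
      by der_eq; rewrite /m1 /D /=; ring.
    - by move=> t; exact: expR_gt0.
    - have h1 := Ux a b; have h2 := Vx a b; have h3 := has_grad_dx gu; have h4 := has_grad_dx gv.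
      by rewrite /m1 /D; der_eq => /=; ring.
    - exact: aL'.
    - move=> t tL; apply: (Wmax (t, b)); rewrite KP; lra.
  have [w1 w2] : m2 b = 0 /\ 2 * (u a b ^+2 + v a b ^+ 2 - U a b * p + V a b * r)
     + 2 * (V a b * u a b - U a b * v a b) * (- (s * (2 * (L - b)))) + D a b * (s * 2) <= 0.
    apply: (@second_order_max R (fun y => W s a y) m2 (fun y => expR (th s a y)) 0 L).
    - move=> t; have h1 := Uy a t; have h2 := Vy a t; rewrite /W /D /th.
      by der_eq; rewrite /m2 /D /=; ring.
    - by move=> t; exact: expR_gt0.
    - have h1 := Uy a b; have h2 := Vy a b; have h3 := has_grad_dy gu; have h4 := has_grad_dy gv.
      by rewrite /m2 /D; der_eq => /=; ring.
    - exact: b'.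
    - move=> t tL; apply: (Wmax (a, t)); rewrite KP; lra.
  (* The Laplacian of [D] is four times [u ^ 2 + v ^ 2], and so is the square
     of its gradient divided by [D]: in the sum only the term coming from
     [x ^ 2] survives. *)
  have sum0 : (4 * (u a b ^+2 + v a b ^+ 2)
    + 2 * (U a b * u a b + V a b * v a b) * (2 * a - s * (2 * a))
    + 2 * (V a b * u a b - U a b * v a b) * (- (s * (2 * (L - b)))) + 2 * D a b) * D a b <= 0.
    by rewrite pmulr_lle0//; lra.
  move: sum0 z1 w1; rewrite /m1 /m2.
  set tx := 2 * a - s * _; set ty := - (s * _) => sum0 z1 w1.
  suff : 2 * D a b ^+ 2 <= 0 by have := exprn_gt0 2 Dp; lra.
  apply: le_trans sum0; rewrite le_eqVlt; apply/orP; left; apply/eqP.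
  have e1 : D a b * tx = - (2 * (U a b * u a b + V a b * v a b)) by lra.
  have e2 : D a b * ty = - (2 * (V a b * u a b - U a b * v a b)) by lra.
  rewrite !mulrDl -![_ * tx * _]mulrA -![_ * ty * _]mulrA ![_ * D a b]mulrC e1 e2 /D; ring.
have D0y y' : 0 < y' < L -> D 0 y' = 0.
  move=> /andP[y1 y2]; apply/eqP/negPn/negP => Dn.
  have Dp : 0 < D 0 y' by rewrite lt_neqAle eq_sym Dn D0.
  pose q := (L - y') ^+ 2; have q0 : 0 < q by rewrite exprn_gt0//; lra.
  pose C := M * expR (L ^+ 2).
  have C0 : 0 <= C by rewrite mulr_ge0 ?expR_ge0// D0.
  pose s := C / (D 0 y' * q).
  have s0 : 0 <= s by rewrite divr_ge0// ltW// mulr_gt0.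
  have := Wle s s0 0 y'; rewrite KP => /(_ ltac:(lra)).
  rewrite /W /th expr0n /= subr0 addr0 -/q -/C => H.
  have : D 0 y' * (1 + s * q) <= C.
    by apply: le_trans H; rewrite ler_pM2l// expR_ge1Dx.
  have -> : D 0 y' * (1 + s * q) = D 0 y' + C by rewrite /s; field; rewrite !gt_eqF.
  lra.
have UVz y' : 0 < y' < L -> U 0 y' = 0 /\ V 0 y' = 0.
  move=> /D0y /eqP; rewrite paddr_eq0 ?sqr_ge0// !sqrf_eq0 => /andP[/eqP -> /eqP ->] //.
have near0 (f : R -> R) l : (forall y', 0 < y' < L -> f y' = 0) -> is_derive y 1 f l -> l = 0.
  move=> f0 hf; apply: (is_derive_uniq hf).
  apply: (@near_eq_is_derive _ _ _ (fun=> 0)).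
  near=> z; rewrite /= f0//; apply/andP; split; near: z.
    exact: lt_nbhsr.
  exact: lt_nbhsl.
split; first by apply: near0 (Vy 0 y) => z /UVz[].
by apply/eqP; rewrite -oppr_eq0; apply/eqP; apply: near0 (Uy 0 y) => z /UVz[].
Unshelve. all: by end_near.
Qed.
End unique_continuation.

(** The hypotheses are invariant under horizontal translations and under
    [z |-> - z], which reduces all points to those of [holo_zero_up]. *)
Theorem holo_zero (R : realType) (u v : R -> R -> R) : holo u v ->
  (forall x, u x 0 = 0 /\ v x 0 = 0) -> forall x y, u x y = 0 /\ v x y = 0.
Proof.
move=> uv uv0.
have up (u' v' : R -> R -> R) : holo u' v' -> (forall x, u' x 0 = 0 /\ v' x 0 = 0) ->
    forall x y, 0 < y -> u' x y = 0 /\ v' x y = 0.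
  move=> uv' uv0' x y y0.
  have uv'' : holo (fun s t => u' (x + s) t) (fun s t => v' (x + s) t).
    move=> s t; have [p [r [gu gv]]] := uv' (x + s) t; exists p, r.
    split=> e e0.
      have [d d0 hd] := gu e e0; exists d => // h k h0 k0; rewrite addrA; exact: hd.
    have [d d0 hd] := gv e e0; exists d => // h k h0 k0; rewrite addrA; exact: hd.
  have := holo_zero_up uv'' _ _ y0; rewrite addr0; apply=> x'.
    by have [] := uv0' (x + x').
  by have [] := uv0' (x + x').
move=> x y; have [y0|y0|<-] := ltgtP 0 y; [exact: up| |exact: uv0].
have := up (fun s t => u (- s) (- t)) (fun s t => v (- s) (- t)) _ _ (- x) (- y).
rewrite !opprK; apply; last by rewrite oppr_gt0.
  move=> s t; have [p [r [gu gv]]] := uv (- s) (- t); exists (- p), (- r).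
  split=> e e0.
    have [d d0 hd] := gu e e0; exists d => // h k h0 k0.
    have := hd (- h) (- k); rewrite !normrN => /(_ h0 k0); rewrite !opprD.
    by congr (`|_| <= _); ring.
  have [d d0 hd] := gv e e0; exists d => // h k h0 k0.
  have := hd (- h) (- k); rewrite !normrN => /(_ h0 k0); rewrite !opprD.
  by congr (`|_| <= _); ring.
by move=> s; rewrite oppr0; exact: uv0.
Qed.

(** * The identity theorem for entire maps of the complex plane *)

Lemma cplx_normE (R : realType) (z : Cplx R) : `|z| = ((normc z)%:C)%C.
Proof. by rewrite normc_def; case: z. Qed.

Lemma cplx_gt0 (R : realType) (d : Cplx R) : 0 < d -> exists2 r : R, 0 < r & d = (r%:C)%C.
Proof. by case: d => a b; rewrite ltcE /= => /andP[/eqP-> a0]; exists a. Qed.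

Lemma normc_Re (R : realType) (z : R[i]) : `|complex.Re z| <= normc z.
Proof. by rewrite Defs.normcE; exact: (norm2_fst (complex.Re z, complex.Im z)). Qed.

Lemma normc_Im (R : realType) (z : R[i]) : `|complex.Im z| <= normc z.
Proof. by rewrite Defs.normcE; exact: (norm2_snd (complex.Re z, complex.Im z)). Qed.

Lemma norm2_le_sum (R : realType) (x : R * R) : norm2 x <= `|x.1| + `|x.2|.
Proof.
have h : 0 <= `|x.1| + `|x.2| by rewrite addr_ge0.
rewrite -(ger0_norm h) -sqrtr_sqr; apply: ler_wsqrtr.
rewrite sqrrD !real_normK ?num_real// lerD2r lerDl mulrn_wge0//.
Qed.

Lemma normc_le_sum (R : realType) (z : R[i]) : normc z <= `|complex.Re z| + `|complex.Im z|.
Proof. by rewrite Defs.normcE; exact: norm2_le_sum. Qed.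

Lemma cderivable_eps (R : realType) (g : Cplx R -> Cplx R) (z : Cplx R) : derivable g z 1 ->
  exists d : Cplx R, forall e : R, 0 < e -> exists2 r : R, 0 < r & forall h, normc h < r ->
    normc (g (z + h) - g z - d * h) <= e * normc h.
Proof.
move=> /cvg_ex[d lim]; exists d => e e0.
have e0' : (0 : Cplx R) < (e%:C)%C by rewrite ltcR.
move/cvgrPdistC_le : lim => /(_ _ e0') /nbhs_ballP[r' /= /cplx_gt0[r r0 ->] hr].
exists r => // h hr'; have [->|h0] := eqVneq h 0.
  by rewrite addr0 subrr mulr0 subr0 ComplexField.Normc.normc0 mulr0.
have := hr h; rewrite /ball /= sub0r normrN cplx_normE ltcR => /(_ hr' h0).
have -> : h^-1 *: (g (h *: 1 + z) - g z) - d = h^-1 * (g (z + h) - g z - d * h).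
  rewrite [h *: 1]mulr1 [z + h]addrC !mulrBr mulrCA mulVf// mulr1.
  by rewrite -mulrBr.
rewrite cplx_normE lecR ComplexField.Normc.normcM ComplexField.Normc.normcV.
rewrite mulrC ler_pdivrMr// lt_neqAle normc_ge0 andbT eq_sym.
by apply: contra h0 => /eqP /ComplexField.Normc.eq0_normc ->.
Qed.

Lemma eps_cderivable (R : realType) (g : Cplx R -> Cplx R) (z d : Cplx R) :
  (forall e : R, 0 < e -> exists2 r : R, 0 < r & forall h, normc h < r ->
    normc (g (z + h) - g z - d * h) <= e * normc h) -> derivable g z 1.
Proof.
move=> H; apply/cvg_ex; exists d; apply/cvgrPdistC_le => _ /cplx_gt0[e e0 ->].
have [r r0 hr] := H e e0.
apply/nbhs_ballP; exists (r%:C)%C => /=; first by rewrite ltcR.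
move=> h; rewrite /ball /= sub0r normrN cplx_normE ltcR => hr' h0.
have -> : h^-1 *: (g (h *: 1 + z) - g z) - d = h^-1 * (g (z + h) - g z - d * h).
  rewrite [h *: 1]mulr1 [z + h]addrC !mulrBr mulrCA mulVf// mulr1.
  by rewrite -mulrBr.
rewrite cplx_normE lecR ComplexField.Normc.normcM ComplexField.Normc.normcV.
rewrite mulrC ler_pdivrMr; first exact: hr.
rewrite lt_neqAle normc_ge0 andbT eq_sym.
by apply: contra h0 => /eqP /ComplexField.Normc.eq0_normc ->.
Qed.

Lemma cderivable_holo (R : realType) (g : Cplx R -> Cplx R) : (forall z, derivable g z 1) ->
  holo (fun x y => complex.Re (g (x +i* y)%C)) (fun x y => complex.Im (g (x +i* y)%C)).
Proof.
move=> dg x y; have [[p r'] hd] := cderivable_eps (dg (x +i* y)%C).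
exists p, (- r'); rewrite opprK; split=> e e0; have [d d0 Hd] := hd e e0.
all: exists (d / 2); first by lra.
all: move=> h k h0 k0.
all: have hk : normc (h +i* k)%C <= `|h| + `|k| by exact: normc_le_sum.
all: have := Hd (h +i* k)%C (le_lt_trans hk _).
all: rewrite (_ : (Complex x y + Complex h k = Complex (x + h) (y + k)))//.
all: move=> /(_ ltac:(lra)) H.
all: apply: (@le_trans _ _ (e * normc (h +i* k)%C)); last by apply: ler_wpM2l => //; exact: ltW.
all: apply: le_trans H.
  apply: le_trans (normc_Re _).
  case: (g (Complex (x + h) (y + k))) => a1 b1; case: (g (x +i* y)%C) => a2 b2 /=.
  by rewrite le_eqVlt; apply/orP; left; apply/eqP; congr (`|_|); ring.
apply: le_trans (normc_Im _).
case: (g (Complex (x + h) (y + k))) => a1 b1; case: (g (x +i* y)%C) => a2 b2 /=.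
by rewrite le_eqVlt; apply/orP; left; apply/eqP; congr (`|_|); ring.
Qed.

Lemma cderivable_zero (R : realType) (g : Cplx R -> Cplx R) : (forall z, derivable g z 1) ->
  (forall x : R, g (x%:C)%C = 0) -> forall z, g z = 0.
Proof.
move=> /cderivable_holo hg g0 [x y].
have [] := holo_zero hg _ x y.
  by move=> t; rewrite (g0 t).
by case: (g _) => a b /= -> ->.
Qed.

Lemma differentiable_fst (R : realType) (z : Cplx R * Cplx R) :
  differentiable (fst : Cplx R * Cplx R -> Cplx R) z.
Proof. apply: linear_differentiable; move=> x; exact: cvg_fst. Qed.

Lemma differentiable_snd (R : realType) (z : Cplx R * Cplx R) :
  differentiable (snd : Cplx R * Cplx R -> Cplx R) z.
Proof. apply: linear_differentiable; move=> x; exact: cvg_snd. Qed.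

(** The one-variable statement is applied to the first coordinate, the second
    being real, and then to the second one. *)
Lemma entire_zero (R : realType) (G : Cplx R * Cplx R -> Cplx R * Cplx R) :
  holomorphic_on setT G -> (forall x, G (embC2 x) = 0) -> forall z, G z = 0.
Proof.
move=> hG G0.
have sl (p : Cplx R * Cplx R -> Cplx R) : (forall z, differentiable p z) ->
    (forall x, p (embC2 x) = 0) -> forall z, p z = 0.
  move=> dp p0.
  have p1 z1 (y : R) : p (z1, (y%:C)%C) = 0.
    apply: (@cderivable_zero R (fun s => p (s, (y%:C)%C))) => [s|x].
      apply/derivable1_diffP.
      apply: (@differentiable_comp _ _ _ _ (fun s : Cplx R => (s, (y%:C)%C : Cplx R)) p) => //.
    exact: (p0 (x, y)).
  move=> [z1 z2]; apply: (@cderivable_zero R (fun s => p (z1, s))) => [s|x].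
    apply/derivable1_diffP.
    apply: (@differentiable_comp _ _ _ _ (fun s : Cplx R => (z1, s : Cplx R)) p) => //.
  exact: p1.
move=> z; rewrite (surjective_pairing (G z)).
congr (_, _).
  apply: (sl (fst \o G)) => [w|x]; last by rewrite /= G0.
  by apply: differentiable_comp; [exact: hG|exact: differentiable_fst].
apply: (sl (snd \o G)) => [w|x]; last by rewrite /= G0.
by apply: differentiable_comp; [exact: hG|exact: differentiable_snd].
Qed.

(** * Entire maps commuting with integer translations *)

Section strips.
Variable R : realType.
Local Notation C2 := (Cplx R * Cplx R)%type.
Implicit Types (z w : C2) (G : C2 -> C2).

Definition intC2 (p q : int) : C2 := embC2 (p%:~R : R, q%:~R : R).

Definition commutes_Z2C G : Prop := forall z (p q : int), G (z + intC2 p q) = G z + intC2 p q.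

Lemma normc_fst z : normc z.1 <= normC2 z.
Proof. by have := norm2_fst (normc z.1, normc z.2); rewrite /= ger0_norm ?normc_ge0. Qed.

Lemma normc_snd z : normc z.2 <= normC2 z.
Proof. by have := norm2_snd (normc z.1, normc z.2); rewrite /= ger0_norm ?normc_ge0. Qed.

Lemma normC2_le_sum z : normC2 z <= normc z.1 + normc z.2.
Proof. by apply: le_trans (norm2_le_sum _) _; rewrite /= !ger0_norm ?normc_ge0. Qed.

Lemma normC2C z w : normC2 (z - w) = normC2 (w - z).
Proof. by rewrite -normC2N opprB. Qed.

Lemma continuous_eps G z : {for z, continuous G} -> forall e : R, 0 < e -> exists2 d : R, 0 < d &
  forall w, normC2 (w - z) < d -> normC2 (G w - G z) < e.
Proof.
move=> cG e e0.
have e0' : (0 : Cplx R) < ((e / 2)%:C)%C by rewrite ltcR divr_gt0.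
move/cvg_ballP : cG => /(_ _ e0') /nbhs_ballP[r' /= /cplx_gt0[r r0 ->] hr].
exists r; first exact: r0.
move=> w wz; have [h1 h2] : ball (G z) ((e / 2)%:C)%C (G w).
  apply: hr; split; rewrite /ball /= cplx_normE ltcR -normcN opprB.
    exact: (le_lt_trans (normc_fst (w - z)) wz).
  exact: (le_lt_trans (normc_snd (w - z)) wz).
move: h1 h2; rewrite /ball /= !cplx_normE !ltcR => h1 h2.
rewrite normC2C; apply: le_lt_trans (normC2_le_sum _) _.
by rewrite [e]splitr ltrD.
Qed.

Definition C2_of_R4 (t : (R * R) * (R * R)) : C2 := (Complex t.1.1 t.1.2, Complex t.2.1 t.2.2).

Lemma C2_of_R4_near (t : (R * R) * (R * R)) (d : R) : 0 < d ->
  \forall s \near t, normC2 (C2_of_R4 s - C2_of_R4 t) < d.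
Proof.
move=> d0; apply/nbhs_ballP; exists (d / 4) => /=; first by rewrite divr_gt0.
case: t => [[a b] [c e]] [[a' b'] [c' e']] [[/= h1 h2] [/= h3 h4]].
apply: le_lt_trans (normC2_le_sum _) _.
move: h1 h2 h3 h4; rewrite /ball /= => h1 h2 h3 h4.
have := normc_le_sum (Complex a' b' - Complex a b).
have := normc_le_sum (Complex c' e' - Complex c e).
rewrite /= [`|a' - a|]distrC [`|b' - b|]distrC [`|c' - c|]distrC [`|e' - e|]distrC; lra.
Qed.

Definition cell (s : R) : set ((R * R) * (R * R)) :=
  (`[0, 1]%classic `*` `[- s, s]%classic) `*` (`[0, 1]%classic `*` `[- s, s]%classic).

Lemma compact_cell s : compact (cell s).
Proof. by apply: compact_setX; apply: compact_setX; exact: segment_compact. Qed.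

Lemma reduce_cell s z : `|complex.Im z.1| <= s -> `|complex.Im z.2| <= s ->
  exists2 t, cell s t & exists p q : int, z = C2_of_R4 t + intC2 p q.
Proof.
case: z => [[a b] [c d]] /= h1 h2.
have fl (x : R) : 0 <= x - (Num.floor x)%:~R <= 1.
  have := floor_le x; have := floorD1_gt x; rewrite intrD => ? ?; lra.
exists ((a - (Num.floor a)%:~R, b), (c - (Num.floor c)%:~R, d)).
  by move: h1 h2; rewrite !ler_norml => h1 h2; split; split; rewrite /= in_itv /=.
exists (Num.floor a), (Num.floor c); congr (_, _).
  by apply/eqP; rewrite eq_complex /= subrK addr0 !eqxx.
by apply/eqP; rewrite eq_complex /= subrK addr0 !eqxx.
Qed.

(** The displacement is periodic, so it is enough to bound it on a compact cell. *)
Lemma commutes_Z2C_bounded G s : continuous G -> commutes_Z2C G -> exists2 C : R, 0 < C &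
  forall z, `|complex.Im z.1| <= s -> `|complex.Im z.2| <= s -> normC2 (G z - z) <= C.
Proof.
move=> cG ZG.
have := compact_near_coveringP (cell s) => -[/(_ (@compact_cell s)) H _].
have [|M [_ HM]] := H R +oo (fun C t => normC2 (G (C2_of_R4 t) - C2_of_R4 t) <= C) _.
  move=> t _; have [d d0 hd] := continuous_eps (cG (C2_of_R4 t)) (@ltr01 R).
  exists ([set s | normC2 (C2_of_R4 s - C2_of_R4 t) < Num.min d 1],
          [set C | 2 + normC2 (G (C2_of_R4 t) - C2_of_R4 t) <= C]) => /=.
    split=> /=; last by apply: nbhs_pinfty_ge; exact: num_real.
    by apply: C2_of_R4_near; rewrite lt_min d0 ltr01.
  move=> [t' C] /= []; rewrite lt_min => /andP[/hd h1 h2] hC; apply: le_trans hC.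
  have -> : G (C2_of_R4 t') - C2_of_R4 t' = (G (C2_of_R4 t') - G (C2_of_R4 t)) +
     ((G (C2_of_R4 t) - C2_of_R4 t) + - (C2_of_R4 t' - C2_of_R4 t)).
    by rewrite opprB (addrA (_ - C2_of_R4 t)) subrK addrA subrK.
  apply: le_trans (ler_normC2D _ _) _; apply: le_trans (lerD (lexx _) (ler_normC2D _ _)) _.
  rewrite normC2N; lra.
exists (Num.max (M + 1) 1); first by rewrite lt_max ltr01 orbT.
move=> z z1 z2; have [t ct [p [q ->]]] := reduce_cell z1 z2.
rewrite ZG opprD addrACA subrr addr0; apply: (@le_trans _ _ (M + 1)).
  by apply: HM ct; lra.
by rewrite le_max lexx.
Qed.

Lemma commutes_Z2C_unif G s (e : R) : continuous G -> commutes_Z2C G -> 0 < e ->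
  exists2 d : R, 0 < d &
  forall z w, `|complex.Im z.1| <= s -> `|complex.Im z.2| <= s -> normC2 (w - z) < d ->
   normC2 (G w - G z) <= e.
Proof.
move=> cG ZG e0.
have := compact_near_coveringP (cell s) => -[/(_ (@compact_cell s)) H _].
have [|d] := H R (0 : R)^'+ (fun d t =>
   forall w, normC2 (w - C2_of_R4 t) < d -> normC2 (G w - G (C2_of_R4 t)) <= e) _.
  move=> t _; have e20 : 0 < e / 2 by rewrite divr_gt0.
  have [d d0 hd] := continuous_eps (cG (C2_of_R4 t)) e20.
  exists ([set s | normC2 (C2_of_R4 s - C2_of_R4 t) < d / 2], [set r | r < d / 2]) => /=.
    split=> /=; first by apply: C2_of_R4_near; rewrite divr_gt0.
    by apply: nbhs_right_lt; rewrite divr_gt0.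
  move=> [t' r] /= [h1 h2] w wt.
  have -> : G w - G (C2_of_R4 t') = (G w - G (C2_of_R4 t)) + - (G (C2_of_R4 t') - G (C2_of_R4 t)).
    by rewrite opprB addrA subrK.
  apply: le_trans (ler_normC2D _ _) _; rewrite normC2N.
  have h3 : normC2 (C2_of_R4 t' - C2_of_R4 t) < d by lra.
  have h4 : normC2 (w - C2_of_R4 t) < d.
    have -> : w - C2_of_R4 t = (w - C2_of_R4 t') + (C2_of_R4 t' - C2_of_R4 t).
      by rewrite addrA subrK.
    by apply: le_lt_trans (ler_normC2D _ _) _; lra.
  have := hd _ h3; have := hd _ h4; lra.
move=> /= d0 hd.
exists (d / 2); first by rewrite divr_gt0.
move=> z w z1 z2; have [t ct [p [q ->]]] := reduce_cell z1 z2.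
have E u v : (u + intC2 p q) - (v + intC2 p q) = u - v :> C2.
  by rewrite opprD addrACA subrr addr0.
rewrite -(subrK (intC2 p q) w); set w' := w - _; rewrite !ZG !E => wt.
apply: (hd (d / 2)) => //=; rewrite ?divr_gt0//.
rewrite sub0r normrN ger0_norm; lra.
Qed.

End strips.

(** * Smooth maps of the plane *)

Section directional.
Variables (R : realType) (W : normedModType R).

(** Derivatives with the same difference quotients: this transfers directional
    derivatives in the plane to derivatives on a line. *)
Lemma is_derive_quot (V V' : normedModType R) (f : V -> W) (g : V' -> W) x v x' v' (d : W) :
  (forall h : R, f (h *: v + x) = g (h *: v' + x')) -> f x = g x' ->
  is_derive x v f d -> is_derive x' v' g d.
Proof.
move=> fg fgx [df fd].
have E : (fun h : R => h^-1 *: (f (h *: v + x) - f x)) =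
         (fun h : R => h^-1 *: (g (h *: v' + x') - g x')).
  by apply/funext => h; rewrite fg fgx.
apply: DeriveDef.
  by move: df; rewrite /derivable /= E.
by rewrite -fd /derive /= E.
Qed.

Lemma is_derive_line1 (f : R * R -> W) (x y : R) (d : W) :
  is_derive (x, y) (1, 0) f d <-> is_derive x 1 (fun t => f (t, y)) d.
Proof.
have E h : h *: ((1, 0) : R * R) + (x, y) = (h *: 1 + x, y).
  by congr (_, _); rewrite /= scaler0 add0r.
by split; apply: is_derive_quot => // h; rewrite E.
Qed.

Lemma is_derive_line2 (f : R * R -> W) (x y : R) (d : W) :
  is_derive (x, y) (0, 1) f d <-> is_derive y 1 (fun t => f (x, t)) d.
Proof.
have E h : h *: ((0, 1) : R * R) + (x, y) = (x, h *: 1 + y).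
  by congr (_, _); rewrite /= scaler0 add0r.
by split; apply: is_derive_quot => // h; rewrite E.
Qed.

End directional.

Lemma is_derive_pairP (R : realType) (V : normedModType R) (F : V -> R * R) x v (d : R * R) :
  is_derive x v F d <->
  is_derive x v (fun x => (F x).1) d.1 /\ is_derive x v (fun x => (F x).2) d.2.
Proof.
split=> [[dF Fd]|[[d1 e1] [d2 e2]]].
  have lim : h^-1 *: (F (h *: v + x) - F x) @[h --> (0 : R)^'] --> d by rewrite -Fd.
  have lim1 : h^-1 *: ((F (h *: v + x)).1 - (F x).1) @[h --> (0 : R)^'] --> d.1.
    have c : {for d, continuous (fst : R * R -> R)} by exact: cvg_fst.
    have L := continuous_cvg _ c lim.
    exact: L.
  have lim2 : h^-1 *: ((F (h *: v + x)).2 - (F x).2) @[h --> (0 : R)^'] --> d.2.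
    have c : {for d, continuous (snd : R * R -> R)} by exact: cvg_snd.
    have L := continuous_cvg _ c lim.
    exact: L.
  split; apply: DeriveDef.
  - by apply/cvg_ex; exists d.1.
  - exact: cvg_lim.
  - by apply/cvg_ex; exists d.2.
  - exact: cvg_lim.
have lim1 : h^-1 *: ((F (h *: v + x)).1 - (F x).1) @[h --> (0 : R)^'] --> d.1 by rewrite -e1.
have lim2 : h^-1 *: ((F (h *: v + x)).2 - (F x).2) @[h --> (0 : R)^'] --> d.2 by rewrite -e2.
have lim : h^-1 *: (F (h *: v + x) - F x) @[h --> (0 : R)^'] --> d.
  rewrite [d]surjective_pairing.
  have -> : (fun h => h^-1 *: (F (h *: v + x) - F x)) =
    (fun h => (h^-1 *: ((F (h *: v + x)).1 - (F x).1), h^-1 *: ((F (h *: v + x)).2 - (F x).2))).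
    by apply/funext => h; rewrite [LHS]surjective_pairing.
  exact: cvg_pair lim1 lim2.
apply: DeriveDef; first by apply/cvg_ex; exists d.
exact: cvg_lim.
Qed.

Section smoothness.
Variable R : realType.
Implicit Types u v a b : R -> R -> R.

(** A scalar and curried counterpart of [class_C].  Its derivatives are given by
    witnesses instead of the operator ['D_v], which makes the closure properties
    provable by plain induction on the order. *)
Fixpoint Ck (k : nat) u : Prop :=
  (forall x y, cont2 u x y) /\
  if k is k'.+1 then
    exists u1 u2, [/\ forall x y : R, is_derive x 1 (u^~ y) (u1 x y),
      forall x y : R, is_derive y 1 (u x) (u2 x y), Ck k' u1 & Ck k' u2]
  else True.

Lemma Ck_cont k u x y : Ck k u -> cont2 u x y.
Proof. by case: k => [|k] []. Qed.

Lemma Ck_weaken k u : Ck k.+1 u -> Ck k u.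
Proof.
elim: k u => [|k IH] u [cu [u1 [u2 [h1 h2 c1 c2]]]]; split=> //.
by exists u1, u2; split=> //; apply: IH.
Qed.

Lemma Ck_cst k (c : R) : Ck k (fun _ _ => c).
Proof.
elim: k c => [|k IH] c; have cc x y : cont2 (fun _ _ : R => c) x y.
- by move=> e e0; exists 1 => // h k' _ _; rewrite subrr normr0 ltW.
- by [].
- by move=> e e0; exists 1 => // h k' _ _; rewrite subrr normr0 ltW.
split=> //; exists (fun _ _ => 0), (fun _ _ => 0); split=> // x y; exact: der_cst.
Qed.

Lemma Ck_proj1 k : Ck k (fun x _ => x).
Proof.
case: k => [|k]; (split; first by
  move=> x y e e0; exists e => // h k' he _; rewrite addrAC subrr add0r ltW) => //.
exists (fun _ _ => 1), (fun _ _ => 0); split => [x y|x y||]; try exact: Ck_cst.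
  exact: der_id.
exact: der_cst.
Qed.

Lemma Ck_proj2 k : Ck k (fun _ y => y).
Proof.
case: k => [|k]; (split; first by
  move=> x y e e0; exists e => // h k' _ he; rewrite addrAC subrr add0r ltW) => //.
exists (fun _ _ => 0), (fun _ _ => 1); split => [x y|x y||]; try exact: Ck_cst.
  exact: der_cst.
exact: der_id.
Qed.

Lemma Ck_add k u v : Ck k u -> Ck k v -> Ck k (fun x y => u x y + v x y).
Proof.
have cc u' v' : (forall x y, cont2 u' x y) -> (forall x y, cont2 v' x y) ->
    forall x y, cont2 (fun x y => u' x y + v' x y) x y.
  move=> cu cv x y; apply/cont2P; apply: continuous_add; apply/cont2P; [exact: cu|exact: cv].
elim: k u v => [|k IH] u v [cu hu] [cv hv]; split; try exact: cc; first by [].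
have [u1 [u2 [d1 d2 c1 c2]]] := hu; have [v1 [v2 [d1' d2' c1' c2']]] := hv.
exists (fun x y => u1 x y + v1 x y), (fun x y => u2 x y + v2 x y).
split=> [x y|x y||]; try exact: IH.
  exact: derD.
exact: derD.
Qed.

Lemma Ck_mul k u v : Ck k u -> Ck k v -> Ck k (fun x y => u x y * v x y).
Proof.
have cc u' v' : (forall x y, cont2 u' x y) -> (forall x y, cont2 v' x y) ->
    forall x y, cont2 (fun x y => u' x y * v' x y) x y.
  move=> cu cv x y; apply/cont2P; apply: continuous_mul; apply/cont2P; [exact: cu|exact: cv].
elim: k u v => [|k IH] u v hu hv.
  by split=> // x y; apply: cc => x' y'; [exact: Ck_cont hu|exact: Ck_cont hv].
split; first by apply: cc => x' y'; [exact: Ck_cont hu|exact: Ck_cont hv].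
have [_ [u1 [u2 [d1 d2 c1 c2]]]] := hu; have [_ [v1 [v2 [d1' d2' c1' c2']]]] := hv.
have wu := Ck_weaken hu; have wv := Ck_weaken hv.
exists (fun x y => u x y * v1 x y + v x y * u1 x y), (fun x y => u x y * v2 x y + v x y * u2 x y).
split=> [x y|x y||]; try by apply: Ck_add; apply: IH.
  exact: derM.
exact: derM.
Qed.

Lemma has_grad_comp u (a b : R -> R) (t p1 p2 a' b' : R) : has_grad u (a t) (b t) p1 p2 ->
  is_derive t 1 a a' -> is_derive t 1 b b' ->
  is_derive t 1 (fun t => u (a t) (b t)) (p1 * a' + p2 * b').
Proof.
move=> gu da db; apply: is_derive_of_eps => e e0.
pose M := 2 + `|a'| + `|b'|.
have M0 : 0 < M by rewrite /M; have := normr_ge0 a'; have := normr_ge0 b'; lra.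
pose N := 1 + `|p1| + `|p2|.
have N0 : 0 < N by rewrite /N; have := normr_ge0 p1; have := normr_ge0 p2; lra.
pose e1 := e / (2 * M); have e10 : 0 < e1 by rewrite divr_gt0// mulr_gt0.
pose e2 := Num.min 1 (e / (2 * N)).
have e20 : 0 < e2 by rewrite lt_min ltr01 divr_gt0// mulr_gt0.
have [d1 d10 h1] := gu e1 e10.
have [d2 d20 h2] := is_derive_eps da e20.
have [d3 d30 h3] := is_derive_eps db e20.
exists (Num.min (d1 / M) (Num.min d2 d3)); first by rewrite !lt_min d20 d30 divr_gt0.
move=> h; rewrite !lt_min => /and3P[hd1 /h2 ea /h3 eb].
set da' := a (t + h) - a t - a' * h in ea; set db' := b (t + h) - b t - b' * h in eb.
have e21 : e2 <= 1 by rewrite ge_min lexx.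
have e22 : e2 * N <= e / 2.
  have : e2 <= e / (2 * N) by rewrite ge_min lexx orbT.
  rewrite -(ler_pM2r N0) => /le_trans; apply.
  by rewrite le_eqVlt; apply/orP; left; apply/eqP; field; rewrite gt_eqF.
have n0 := normr_ge0 h.
have hM : `|h| * M < d1 by rewrite -ltr_pdivlMr.
have na : `|a (t + h) - a t| <= (1 + `|a'|) * `|h|.
  have -> : a (t + h) - a t = da' + a' * h by rewrite /da'; ring.
  apply: le_trans (ler_normD _ _) _; rewrite normrM mulrDl; apply: lerD => //.
  by apply: le_trans ea _; rewrite ler_wpM2r.
have nb : `|b (t + h) - b t| <= (1 + `|b'|) * `|h|.
  have -> : b (t + h) - b t = db' + b' * h by rewrite /db'; ring.
  apply: le_trans (ler_normD _ _) _; rewrite normrM mulrDl; apply: lerD => //.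
  by apply: le_trans eb _; rewrite ler_wpM2r.
have pa : 0 <= `|a'| * `|h| by rewrite mulr_ge0.
have pb : 0 <= `|b'| * `|h| by rewrite mulr_ge0.
have := h1 (a (t + h) - a t) (b (t + h) - b t).
rewrite [a t + _]addrC [b t + _]addrC !subrK.
have s1 : `|a (t + h) - a t| < d1 by move: hM; rewrite /M; lra.
have s2 : `|b (t + h) - b t| < d1 by move: hM; rewrite /M; lra.
move=> /(_ s1 s2) E.
have -> : u (a (t + h)) (b (t + h)) - u (a t) (b t) - (p1 * a' + p2 * b') * h =
  (u (a (t + h)) (b (t + h)) - u (a t) (b t) - p1 * (a (t + h) - a t) - p2 * (b (t + h) - b t))
  + (p1 * da' + p2 * db') by rewrite /da' /db'; ring.
apply: le_trans (ler_normD _ _) _.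
have E1 : e1 * (`|a (t + h) - a t| + `|b (t + h) - b t|) <= e / 2 * `|h|.
  apply: (@le_trans _ _ (e1 * (M * `|h|))).
    by rewrite ler_pM2l// /M; lra.
  by rewrite le_eqVlt; apply/orP; left; apply/eqP; rewrite /e1; field; rewrite gt_eqF.
have E2 : `|p1 * da' + p2 * db'| <= e / 2 * `|h|.
  apply: le_trans (ler_normD _ _) _; rewrite !normrM.
  apply: (@le_trans _ _ (e2 * N * `|h|)); last by rewrite ler_wpM2r.
  have := ler_wpM2l (normr_ge0 p1) ea; have := ler_wpM2l (normr_ge0 p2) eb.
  have : 0 <= e2 * `|h| by rewrite mulr_ge0// ltW.
  rewrite /N; lra.
lra.
Qed.

Lemma Ck_comp k u a b : Ck k u -> Ck k a -> Ck k b -> Ck k (fun x y => u (a x y) (b x y)).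
Proof.
have cc u' a' b' : (forall x y, cont2 u' x y) -> (forall x y, cont2 a' x y) ->
    (forall x y, cont2 b' x y) -> forall x y, cont2 (fun x y => u' (a' x y) (b' x y)) x y.
  move=> cu ca cb x y e e0; have [d d0 hd] := cu (a' x y) (b' x y) e e0.
  have d20 : 0 < d / 2 by lra.
  have [d1 d10 h1] := ca x y _ d20; have [d2 d21 h2] := cb x y _ d20.
  exists (Num.min d1 d2); first by rewrite lt_min d10.
  move=> h k'; rewrite !lt_min => /andP[hh1 hh2] /andP[k1 k2].
  have H1 := h1 _ _ hh1 k1; have H2 := h2 _ _ hh2 k2.
  have := hd (a' (x + h) (y + k') - a' x y) (b' (x + h) (y + k') - b' x y).
  rewrite ![_ + (_ - _)]addrC !subrK; apply; lra.
elim: k u a b => [|k IH] u a b hu ha hb.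
  by split=> // x y; apply: cc => x' y'; [exact: Ck_cont hu|exact: Ck_cont ha|exact: Ck_cont hb].
split; first by apply: cc => x' y'; [exact: Ck_cont hu|exact: Ck_cont ha|exact: Ck_cont hb].
have [_ [u1 [u2 [d1 d2 c1 c2]]]] := hu.
have [_ [a1 [a2 [da1 da2 ca1 ca2]]]] := ha.
have [_ [b1 [b2 [db1 db2 cb1 cb2]]]] := hb.
have wa := Ck_weaken ha; have wb := Ck_weaken hb.
have gu x y : has_grad u x y (u1 x y) (u2 x y).
  by apply: C1_has_grad => //; [exact: Ck_cont c1|exact: Ck_cont c2].
exists (fun x y => u1 (a x y) (b x y) * a1 x y + u2 (a x y) (b x y) * b1 x y),
  (fun x y => u1 (a x y) (b x y) * a2 x y + u2 (a x y) (b x y) * b2 x y).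
split=> [x y|x y||].
- exact: (has_grad_comp (gu _ _) (da1 x y) (db1 x y)).
- exact: (has_grad_comp (gu _ _) (da2 x y) (db2 x y)).
- by apply: Ck_add; apply: Ck_mul => //; apply: IH.
- by apply: Ck_add; apply: Ck_mul => //; apply: IH.
Qed.

Lemma class_CP k (F : R * R -> R * R) : class_C k F <->
  Ck k (fun x y => (F (x, y)).1) /\ Ck k (fun x y => (F (x, y)).2).
Proof.
have contP (G : R * R -> R * R) : continuous G <->
  (forall x y, cont2 (fun x y => (G (x, y)).1) x y) /\
  (forall x y, cont2 (fun x y => (G (x, y)).2) x y).
  split=> [cG|[c1 c2] [x y]].
    have c1 : continuous (fun z => (G z).1).
      by move=> z; apply: (@continuous_comp _ _ _ G fst); [exact: cG|exact: cvg_fst].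
    have c2 : continuous (fun z => (G z).2).
      by move=> z; apply: (@continuous_comp _ _ _ G snd); [exact: cG|exact: cvg_snd].
    split=> x y; apply/cont2P.
      rewrite (_ : (fun z : R * R => (G (z.1, z.2)).1) = (fun z => (G z).1)).
        exact: c1.
      by apply/funext => -[].
    rewrite (_ : (fun z : R * R => (G (z.1, z.2)).2) = (fun z => (G z).2));
      last by apply/funext => -[].
    exact: c2.
  have -> : G = (fun z => ((G z).1, (G z).2)) by apply/funext => z; exact: surjective_pairing.
  apply: (@cvg_pair _ _ _ _ (nbhs (G (x, y)).1) (nbhs (G (x, y)).2) _ _ _
    (fun z => (G z).1) (fun z => (G z).2)).
    have /cont2P := c1 x y.
    rewrite (_ : (fun z : R * R => (G (z.1, z.2)).1) = (fun z => (G z).1));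
      last by apply/funext => -[].
    exact: id.
  have /cont2P := c2 x y.
  rewrite (_ : (fun z : R * R => (G (z.1, z.2)).2) = (fun z => (G z).2));
    last by apply/funext => -[].
  exact: id.
elim: k F => [|k IH] F.
  by split=> [[/contP[c1 c2] _]|[[c1 _] [c2 _]]]; split=> //; apply/contP.
split=> [[/contP[c1 c2] [dF /IH[c11 c12] /IH[c21 c22]]]|].
  have d1 x y := derivableP (dF (x, y)).1; have d2 x y := derivableP (dF (x, y)).2.
  split; split; [exact: c1| |exact: c2|].
    exists (fun x y => ('D_(1, 0) F (x, y)).1), (fun x y => ('D_(0, 1) F (x, y)).1).
    split; [| |exact: c11|exact: c21] => x y.
      by have /is_derive_pairP[/is_derive_line1] := d1 x y.
    by have /is_derive_pairP[/is_derive_line2] := d2 x y.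
  exists (fun x y => ('D_(1, 0) F (x, y)).2), (fun x y => ('D_(0, 1) F (x, y)).2).
  split; [| |exact: c12|exact: c22] => x y.
    by have /is_derive_pairP[_ /is_derive_line1] := d1 x y.
  by have /is_derive_pairP[_ /is_derive_line2] := d2 x y.
move=> [[c1 [u1 [u2 [du1 du2 cu1 cu2]]]] [c2 [v1 [v2 [dv1 dv2 cv1 cv2]]]]].
have d1 (z : R * R) : is_derive z (1, 0) F (u1 z.1 z.2, v1 z.1 z.2).
  by case: z => x y; apply/is_derive_pairP; split; apply/is_derive_line1.
have d2 (z : R * R) : is_derive z (0, 1) F (u2 z.1 z.2, v2 z.1 z.2).
  by case: z => x y; apply/is_derive_pairP; split; apply/is_derive_line2.
have E1 : 'D_(1, 0) F = fun z => (u1 z.1 z.2, v1 z.1 z.2).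
  by apply/funext => z; have [_ ->] := d1 z.
have E2 : 'D_(0, 1) F = fun z => (u2 z.1 z.2, v2 z.1 z.2).
  by apply/funext => z; have [_ ->] := d2 z.
split; first by apply/contP.
split; last 2 first.
- by rewrite E1; apply/IH.
- by rewrite E2; apply/IH.
by move=> z; have [? _] := d1 z; have [? _] := d2 z.
Qed.

Lemma class_C_comp k (F G : R * R -> R * R) : class_C k F -> class_C k G -> class_C k (F \o G).
Proof.
move=> /class_CP[f1 f2] /class_CP[g1 g2]; apply/class_CP; split.
  have := Ck_comp f1 g1 g2.
  by congr Ck; apply/funext => x; apply/funext => y; rewrite -surjective_pairing.
have := Ck_comp f2 g1 g2.
by congr Ck; apply/funext => x; apply/funext => y; rewrite -surjective_pairing.
Qed.

Lemma Ck_cos_sin k : Ck k (fun x _ => cos x) /\ Ck k (fun x _ => sin x).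
Proof.
have cc (f f' : R -> R) : (forall x : R, is_derive x 1 f (f' x)) ->
    forall x y, cont2 (fun x _ => f x) x y.
  move=> df x y; apply/cont2P.
  apply: (@continuous_comp _ _ _ fst f); first exact: cvg_fst.
  exact: derive_continuous.
have ccos := cc cos _ (fun x => is_derive_cos x).
have csin := cc sin _ (fun x => is_derive_sin x).
elim: k => [|k [IHc IHs]]; first by [].
have z0 := Ck_cst k 0.
split; split=> //.
  exists (fun x _ => -1 * sin x), (fun _ _ => 0); split=> // [x y|x y|].
  - by rewrite mulN1r; exact: is_derive_cos.
  - exact: der_cst.
  - by apply: Ck_mul => //; exact: Ck_cst.
exists (fun x _ => cos x), (fun _ _ => 0); split=> // x y.
  exact: is_derive_sin.
exact: der_cst.
Qed.

Lemma Ck_cos k u : Ck k u -> Ck k (fun x y => cos (u x y)).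
Proof. by move=> hu; have [c _] := Ck_cos_sin k; have := Ck_comp c hu hu. Qed.

End smoothness.

(** * The complex cosine *)

Lemma holo_cderivable (R : realType) (u v : R -> R -> R) : holo u v -> forall z : Cplx R,
  derivable (fun z : Cplx R => (Complex (u (complex.Re z) (complex.Im z))
    (v (complex.Re z) (complex.Im z)) : Cplx R)) z 1.
Proof.
move=> uv [x y]; have [p [r [gu gv]]] := uv x y.
apply: (@eps_cderivable _ _ _ (Complex p (- r))) => e e0.
have e40 : 0 < e / 4 by rewrite divr_gt0.
have [d1 d10 h1] := gu _ e40; have [d2 d20 h2] := gv _ e40.
exists (Num.min d1 d2); first by rewrite lt_min d10.
move=> [h k]; rewrite lt_min => /andP[hk1 hk2].
have nh := normc_Re (Complex h k); have nk := normc_Im (Complex h k).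
have E1 := h1 h k (le_lt_trans nh hk1) (le_lt_trans nk hk1).
have E2 := h2 h k (le_lt_trans nh hk2) (le_lt_trans nk hk2).
have Eh : e / 4 * (`|h| + `|k|) <= e / 2 * normc (Complex h k).
  have -> : e / 2 * normc (Complex h k) =
    e / 4 * (normc (Complex h k) + normc (Complex h k)) by field.
  by rewrite ler_pM2l// lerD.
set n := normc (Complex h k) in Eh *.
apply: le_trans (normc_le_sum _) _ => /=.
set a := (X in `|X| + _); set b := (X in _ + `|X|).
have -> : a = u (x + h) (y + k) - u x y - p * h - r * k by rewrite /a; ring.
have -> : b = v (x + h) (y + k) - v x y - - r * h - p * k by rewrite /b; ring.
lra.
Qed.

Section complex_cosine.
Variable R : realType.

(** The complex cosine in terms of its real and imaginary parts. *)
Definition ccos (z : Cplx R) : Cplx R :=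
  Complex (cos (complex.Re z) * ((expR (complex.Im z) + expR (- complex.Im z)) / 2))
   (- (sin (complex.Re z) * ((expR (complex.Im z) - expR (- complex.Im z)) / 2))).

Lemma ccos_real (x : R) : ccos (x%:C)%C = ((cos x)%:C)%C.
Proof.
rewrite /ccos /= oppr0 expR0 subrr mul0r mulr0 oppr0.
have -> : (1 + 1) / 2 = 1 :> R by lra.
by rewrite mulr1.
Qed.

Lemma ccos_derivable (z : Cplx R) : derivable ccos z 1.
Proof.
apply: (@holo_cderivable R (fun x y => cos x * ((expR y + expR (- y)) / 2))
  (fun x y => - (sin x * ((expR y - expR (- y)) / 2)))).
have [C0 S0] := Ck_cos_sin R 0%N.
have X0 : Ck 0 (fun _ y : R => expR y).
  split=> // x y; apply/cont2P; apply: (@continuous_comp _ _ _ snd expR); first exact: cvg_snd.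
  exact: continuous_expR.
have m10 := Ck_cst 0%N (-1 : R); have h0 := Ck_cst 0%N (2^-1 : R).
have N0 : Ck 0 (fun _ y : R => expR (- y)).
  have := Ck_comp X0 (Ck_cst 0%N 0) (Ck_mul m10 (Ck_proj2 R 0%N)).
  by under [X in Ck 0 X]eq_fun do under eq_fun do rewrite mulN1r.
have dc (x : R) := is_derive_cos x; have ds (x : R) := is_derive_sin x.
have ch0 := Ck_mul (Ck_add X0 N0) h0; have sh0 := Ck_mul (Ck_add X0 (Ck_mul m10 N0)) h0.
move=> x y; exists (-1 * sin x * ((expR y + expR (- y)) * 2^-1)),
  (cos x * ((expR y + -1 * expR (- y)) * 2^-1)).
split.
  apply: (@C1_has_grad R _ (fun x y => -1 * sin x * ((expR y + expR (- y)) * 2^-1))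
      (fun x y => cos x * ((expR y + -1 * expR (- y)) * 2^-1))).
  - by move=> s t; have h := dc s; der_eq => /=; ring.
  - by move=> s t; der_eq => /=; ring.
  - exact: Ck_cont (Ck_mul (Ck_mul m10 S0) ch0).
  - exact: Ck_cont (Ck_mul C0 sh0).
apply: (@C1_has_grad R _ (fun x y => - (cos x * ((expR y + -1 * expR (- y)) * 2^-1)))
  (fun x y => -1 * sin x * ((expR y + expR (- y)) * 2^-1))).
- by move=> s t; have h := ds s; der_eq => /=; ring.
- by move=> s t; der_eq => /=; ring.
- have := Ck_cont x y (Ck_mul m10 (Ck_mul C0 sh0)).
  by under [X in cont2 X]eq_fun do under eq_fun do rewrite mulN1r.
- exact: Ck_cont (Ck_mul (Ck_mul m10 S0) ch0).
Qed.

Lemma cos_periodz (x : R) (n : int) : cos (x + 2 * pi * n%:~R) = cos x.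
Proof.
have per (t : R) : cos (t + 2 * pi) = cos t by rewrite mulr_natl cosD2pi.
have P m (t : R) : cos (t + 2 * pi * m%:R) = cos t.
  elim: m => [|m IH]; first by rewrite mulr0 addr0.
  by rewrite -[m.+1%:R]natr1 mulrDr addrA mulr1 per IH.
case: n => n; first exact: P.
rewrite NegzE intrN mulrN -(P n.+1 (x - _)); congr cos.
by rewrite pmulrn subrK.
Qed.

Lemma sin_periodz (x : R) (n : int) : sin (x + 2 * pi * n%:~R) = sin x.
Proof.
have per (t : R) : sin (t + 2 * pi) = sin t by rewrite mulr_natl sinD2pi.
have P m (t : R) : sin (t + 2 * pi * m%:R) = sin t.
  elim: m => [|m IH]; first by rewrite mulr0 addr0.
  by rewrite -[m.+1%:R]natr1 mulrDr addrA mulr1 per IH.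
case: n => n; first exact: P.
rewrite NegzE intrN mulrN -(P n.+1 (x - _)); congr sin.
by rewrite pmulrn subrK.
Qed.

Lemma ccos_periodz (z : Cplx R) (n : int) : ccos (z + ((2 * pi * n%:~R)%:C)%C) = ccos z.
Proof. by case: z => x y; rewrite /ccos /= addr0 cos_periodz sin_periodz. Qed.

End complex_cosine.

(** * Analytic automorphisms of the plane over the torus *)

(** The maps used for the conjugations: diffeomorphisms of the plane which
    descend to the torus and extend, together with their inverses, to entire maps.
    The compatibility with integer translations is asked for on the complex side,
    where the estimates are made; on the real side it follows. *)
Record entire_auto (R : realType) := EntireAuto {
  fwd : R * R -> R * R;
  bwd : R * R -> R * R;
  fwdC : Cplx R * Cplx R -> Cplx R * Cplx R;
  bwdC : Cplx R * Cplx R -> Cplx R * Cplx R;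
  fwd_ext : extends fwdC fwd;
  bwd_ext : extends bwdC bwd;
  fwdCK : cancel fwdC bwdC;
  bwdCK : cancel bwdC fwdC;
  fwdC_holo : holomorphic_on setT fwdC;
  bwdC_holo : holomorphic_on setT bwdC;
  fwdC_Z : commutes_Z2C fwdC;
  fwd_smooth : forall k, class_C k fwd;
  bwd_smooth : forall k, class_C k bwd }.

Section entire_auto_theory.
Variable R : realType.
Implicit Types (P Q : entire_auto R) (x y : R * R).

Lemma embC2_inj : injective (@embC2 R).
Proof. by move=> [a b] [c d] [] -> ->. Qed.

Lemma fwdK P : cancel (fwd P) (bwd P).
Proof. by move=> x; apply: embC2_inj; rewrite -bwd_ext -fwd_ext fwdCK. Qed.

Lemma bwdK P : cancel (bwd P) (fwd P).
Proof. by move=> x; apply: embC2_inj; rewrite -fwd_ext -bwd_ext bwdCK. Qed.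

Lemma bwdC_Z P : commutes_Z2C (bwdC P).
Proof. by move=> z p q; rewrite -[in LHS](bwdCK P z) -fwdC_Z fwdCK. Qed.

Lemma fwd_Z P x (p q : int) : fwd P (x + (p%:~R, q%:~R)) = fwd P x + (p%:~R, q%:~R).
Proof. by apply: embC2_inj; rewrite -fwd_ext !embC2D fwdC_Z fwd_ext. Qed.

Lemma fwdC_cont P : continuous (fwdC P).
Proof. by move=> z; apply: differentiable_continuous; exact: fwdC_holo. Qed.

Lemma bwdC_cont P : continuous (bwdC P).
Proof. by move=> z; apply: differentiable_continuous; exact: bwdC_holo. Qed.

Lemma fwd_cont P : continuous (fwd P).
Proof. by have [] := fwd_smooth P 0%N. Qed.

Lemma bwd_cont P : continuous (bwd P).
Proof. by have [] := bwd_smooth P 0%N. Qed.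

Definition auto_inv P : entire_auto R :=
  EntireAuto (bwd_ext P) (fwd_ext P) (bwdCK P) (fwdCK P) (bwdC_holo P) (fwdC_holo P)
    (bwdC_Z P) (bwd_smooth P) (fwd_smooth P).

Section comp.
Variables P Q : entire_auto R.
Let e1 : extends (fwdC P \o fwdC Q) (fwd P \o fwd Q).
Proof. by move=> x /=; rewrite !fwd_ext. Qed.
Let e2 : extends (bwdC Q \o bwdC P) (bwd Q \o bwd P).
Proof. by move=> x /=; rewrite !bwd_ext. Qed.
Let c1 : cancel (fwdC P \o fwdC Q) (bwdC Q \o bwdC P).
Proof. by move=> x /=; rewrite !fwdCK. Qed.
Let c2 : cancel (bwdC Q \o bwdC P) (fwdC P \o fwdC Q).
Proof. by move=> x /=; rewrite !bwdCK. Qed.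
Let h1 : holomorphic_on setT (fwdC P \o fwdC Q).
Proof. by move=> z _; apply: differentiable_comp; exact: fwdC_holo. Qed.
Let h2 : holomorphic_on setT (bwdC Q \o bwdC P).
Proof. by move=> z _; apply: differentiable_comp; exact: bwdC_holo. Qed.
Let z1 : commutes_Z2C (fwdC P \o fwdC Q).
Proof. by move=> z p q /=; rewrite !fwdC_Z. Qed.
Let s1 k : class_C k (fwd P \o fwd Q).
Proof. by apply: class_C_comp; exact: fwd_smooth. Qed.
Let s2 k : class_C k (bwd Q \o bwd P).
Proof. by apply: class_C_comp; exact: bwd_smooth. Qed.
Definition auto_comp := EntireAuto e1 e2 c1 c2 h1 h2 z1 s1 s2.
End comp.

Lemma class_C_translation k (a : R * R) : class_C k (fun x => x + a).
Proof.
apply/class_CP; split=> /=; apply: Ck_add; try exact: Ck_cst.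
  exact: Ck_proj1.
exact: Ck_proj2.
Qed.

Section translation.
Variable a : R * R.
Let e1 (b : R * R) : extends (fun z => z + embC2 b) (fun x => x + b).
Proof. by move=> x; rewrite embC2D. Qed.
Let c1 : cancel (fun z => z + embC2 a) (fun z => z + embC2 (- a)).
Proof. by move=> x; rewrite embC2N addrK. Qed.
Let c2 : cancel (fun z => z + embC2 (- a)) (fun z => z + embC2 a).
Proof. by move=> x; rewrite embC2N subrK. Qed.
Let h1 (b : R * R) : holomorphic_on setT (fun z => z + embC2 b).
Proof.
move=> z _; apply: differentiableD; first by have [D _] := is_diff_id z; exact: D.
exact: differentiable_cst.
Qed.
Let z1 : commutes_Z2C (fun z => z + embC2 a).
Proof. by move=> z p q; rewrite addrAC. Qed.
Definition auto_translation := EntireAuto (e1 a) (e1 (- a)) c1 c2 (h1 a) (h1 (- a))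
  z1 (fun k => class_C_translation k a) (fun k => class_C_translation k (- a)).
End translation.

Definition wave (A : R) (Q : nat) (t : R) : R := A * cos (2 * pi * Q%:R * t).

Definition waveC (A : R) (Q : nat) (t : Cplx R) : Cplx R :=
  (A%:C)%C * ccos (((2 * pi * Q%:R)%:C)%C * t).

Lemma waveC_real (A : R) (Q : nat) (t : R) : waveC A Q (t%:C)%C = ((wave A Q t)%:C)%C.
Proof. by rewrite /waveC -rmorphM /= ccos_real -rmorphM. Qed.

Lemma waveC_Z (A : R) (Q : nat) (t : Cplx R) (n : int) :
  waveC A Q (t + ((n%:~R : R)%:C)%C) = waveC A Q t.
Proof.
rewrite /waveC mulrDr -rmorphM /=.
have -> : 2 * pi * Q%:R * n%:~R = 2 * pi * (Q%:Z * n)%:~R :> R by rewrite intrM mulrA.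
by rewrite ccos_periodz.
Qed.

(** A profile whose frequency is a multiple of [q] has period [1 / q]; this makes
    the shears commute with the rotations of denominator [q]. *)
Lemma wave_shift (A : R) (Q q : nat) (t : R) (p : int) : (0 < q)%N -> (q %| Q)%N ->
  wave A Q (t + p%:~R / q%:R) = wave A Q t.
Proof.
move=> q0 /dvdnP[k ->]; rewrite /wave mulrDr.
have -> : 2 * pi * (k * q)%:R * (p%:~R / q%:R) = 2 * pi * (k%:Z * p)%:~R :> R.
  by rewrite intrM natrM; field; rewrite pnatr_eq0 -lt0n.
by rewrite cos_periodz.
Qed.

Lemma waveC_differentiable (A : R) (Q : nat) (t : Cplx R) : differentiable (waveC A Q) t.
Proof.
have d1 : differentiable (fun t : Cplx R => ((2 * pi * Q%:R)%:C)%C *: t) t.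
  by apply: differentiableZ; have [D _] := is_diff_id t; exact: D.
have d2 : differentiable (@ccos R : Cplx R -> Cplx R) (((2 * pi * Q%:R)%:C)%C *: t).
  by apply/derivable1_diffP; exact: ccos_derivable.
have d3 := differentiable_comp d1 d2.
exact: (differentiableZ ((A%:C)%C : Cplx R) d3).
Qed.

Section shear.
Variables (A : R) (Q : nat).

Definition hshear (B : R) x := (x.1 + wave B Q x.2, x.2).
Definition hshearC (B : R) (z : Cplx R * Cplx R) := (z.1 + waveC B Q z.2, z.2).

Let e1 (B : R) : extends (hshearC B) (hshear B).
Proof. by move=> x; rewrite /hshearC /embC2 /= waveC_real rmorphD. Qed.
Let waveN (B : R) t : waveC (- B) Q t = - waveC B Q t.
Proof. by rewrite /waveC rmorphN mulNr. Qed.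
Let c1 (B : R) : cancel (hshearC B) (hshearC (- B)).
Proof. by move=> [z1 z2]; rewrite /hshearC /= waveN addrK. Qed.
Let c2 (B : R) : cancel (hshearC (- B)) (hshearC B).
Proof. by move=> [z1 z2]; rewrite /hshearC /= waveN subrK. Qed.
Let h1 (B : R) : holomorphic_on setT (hshearC B).
Proof.
move=> z _; apply: differentiable_pair; last exact: differentiable_snd.
apply: differentiableD; first exact: differentiable_fst.
apply: (@differentiable_comp _ _ _ _ snd (waveC B Q)); first exact: differentiable_snd.
exact: waveC_differentiable.
Qed.
Let z1 (B : R) : commutes_Z2C (hshearC B).
Proof. by move=> [z1 z2] p q; rewrite /hshearC /= waveC_Z addrAC. Qed.
Let s1 (B : R) k : class_C k (hshear B).
Proof.
apply/class_CP; split=> /=; last exact: Ck_proj2.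
apply: Ck_add; first exact: Ck_proj1.
apply: Ck_mul; first exact: Ck_cst.
apply: Ck_cos; apply: Ck_mul; first exact: Ck_cst.
exact: Ck_proj2.
Qed.
Definition auto_hshear := EntireAuto (e1 A) (e1 (- A)) (c1 A) (c2 A)
  (h1 A) (h1 (- A)) (z1 A) (s1 A) (s1 (- A)).

Definition vshear (B : R) x := (x.1, x.2 + wave B Q x.1).
Definition vshearC (B : R) (z : Cplx R * Cplx R) := (z.1, z.2 + waveC B Q z.1).

Let e1' (B : R) : extends (vshearC B) (vshear B).
Proof. by move=> x; rewrite /vshearC /embC2 /= waveC_real rmorphD. Qed.
Let c1' (B : R) : cancel (vshearC B) (vshearC (- B)).
Proof. by move=> [w1 w2]; rewrite /vshearC /= waveN addrK. Qed.
Let c2' (B : R) : cancel (vshearC (- B)) (vshearC B).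
Proof. by move=> [w1 w2]; rewrite /vshearC /= waveN subrK. Qed.
Let h1' (B : R) : holomorphic_on setT (vshearC B).
Proof.
move=> z _; apply: differentiable_pair; first exact: differentiable_fst.
apply: differentiableD; first exact: differentiable_snd.
apply: (@differentiable_comp _ _ _ _ fst (waveC B Q)); first exact: differentiable_fst.
exact: waveC_differentiable.
Qed.
Let z1' (B : R) : commutes_Z2C (vshearC B).
Proof. by move=> [w1 w2] p q; rewrite /vshearC /= waveC_Z addrAC. Qed.
Let s1' (B : R) k : class_C k (vshear B).
Proof.
apply/class_CP; split=> /=; first exact: Ck_proj1.
apply: Ck_add; first exact: Ck_proj2.
apply: Ck_mul; first exact: Ck_cst.
apply: Ck_cos; apply: Ck_mul; first exact: Ck_cst.
exact: Ck_proj1.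
Qed.
Definition auto_vshear := EntireAuto (e1' A) (e1' (- A)) (c1' A) (c2' A)
  (h1' A) (h1' (- A)) (z1' A) (s1' A) (s1' (- A)).

End shear.

Definition rotation_conj P (a : R * R) :=
  auto_comp P (auto_comp (auto_translation a) (auto_inv P)).

Lemma fwd_bounded P : exists2 C : R, 0 < C & forall x, norm2 (fwd P x - x) <= C.
Proof.
have [C C0 hC] := commutes_Z2C_bounded 0 (@fwdC_cont P) (@fwdC_Z _ P).
exists C => // x; have := hC (embC2 x); rewrite /= normr0 lexx => /(_ isT isT).
by rewrite fwd_ext -embC2N -embC2D normC2_embC2.
Qed.

Lemma fwd_unif P (e : R) : 0 < e -> exists2 d : R, 0 < d &
  forall x y, norm2 (y - x) < d -> norm2 (fwd P y - fwd P x) <= e.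
Proof.
move=> e0; have [d d0 hd] := commutes_Z2C_unif 0 (@fwdC_cont P) (@fwdC_Z _ P) e0.
exists d => // x y xy; have := hd (embC2 x) (embC2 y); rewrite /= normr0 lexx => /(_ isT isT).
by rewrite !fwd_ext -!embC2N -!embC2D !normC2_embC2; exact.
Qed.

(** The inverse of [P] maps the strip into a wider one, on which [P] is uniformly
    continuous, and real translations preserve each strip. *)
Lemma rotation_conj_close P (rho : {posnum R}) (a : R * R) (e : R) : 0 < e -> exists2 d : R, 0 < d &
  forall b, norm2 (b - a) < d ->
  (norm_strip rho%:num
    (fun x => fwd (rotation_conj P b) x - fwd (rotation_conj P a) x)%R <= e%:E)%E.
Proof.
move=> e0; have [C C0 hC] := commutes_Z2C_bounded rho%:num (@bwdC_cont P) (@bwdC_Z P).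
have [d d0 hd] := commutes_Z2C_unif (rho%:num + C) (@fwdC_cont P) (@fwdC_Z _ P) e0.
exists d => // b ab.
pose D z := fwdC (rotation_conj P b) z - fwdC (rotation_conj P a) z.
apply: (@le_trans _ _ (sup_strip rho%:num D)).
  apply: ereal_inf_lbound; exists D; last by [].
  split.
    by move=> z _; apply: differentiableB; exact: fwdC_holo.
  by move=> x; rewrite /D !fwd_ext embC2D embC2N.
apply: ge_ereal_sup => _ [z [z1 z2] <-]; rewrite lee_fin.
have zC := hC z (ltW z1) (ltW z2).
have im1 : `|complex.Im (bwdC P z).1| <= rho%:num + C.
  have -> : (bwdC P z).1 = z.1 + (bwdC P z - z).1 by rewrite /= addrC subrK.
  rewrite raddfD /=; apply: le_trans (ler_normD _ _) _; apply: lerD; first exact: ltW.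
  exact: le_trans (normc_Im _) (le_trans (normc_fst _) zC).
have im2 : `|complex.Im (bwdC P z).2| <= rho%:num + C.
  have -> : (bwdC P z).2 = z.2 + (bwdC P z - z).2 by rewrite /= addrC subrK.
  rewrite raddfD /=; apply: le_trans (ler_normD _ _) _; apply: lerD; first exact: ltW.
  exact: le_trans (normc_Im _) (le_trans (normc_snd _) zC).
rewrite /D /=; apply: hd.
- by rewrite /= raddfD /= addr0.
- by rewrite /= raddfD /= addr0.
- by rewrite opprD addrACA subrr add0r -embC2N -embC2D normC2_embC2.
Qed.

End entire_auto_theory.

(** * Descent to the torus *)

Section torus_realization.
Variable R : realType.
Implicit Types (P Q : entire_auto R) (x y : R * R).

Lemma torus_pi_continuous : continuous (@torus_pi R).
Proof. exact: pi_continuous. Qed.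

Lemma torus_pi_lift (u v : R * R) : torus_pi u = torus_pi v ->
  exists p q : int, u = v + (p%:~R, q%:~R).
Proof.
move=> /torus_pi_eqP /andP[/intrP[p hp] /intrP[q hq]]; exists p, q.
by rewrite -hp -hq -surjective_pairing addrC subrK.
Qed.

(** The projection to the torus is open: the saturation of an open set is the
    union of its integer translates. *)
Lemma torus_pi_nbhs x (B : set (R * R)) : nbhs x B -> nbhs (torus_pi x) (@torus_pi R @` B).
Proof.
rewrite nbhsE => -[U [oU Ux] UB].
apply: (@filterS _ _ _ (@torus_pi R @` U)); first by apply: image_subset.
apply: open_nbhs_nbhs; split; last by exists x.
rewrite /open /= /quotient_open.
have -> : (@torus_pi R) @^-1` (@torus_pi R @` U) =
   \bigcup_(n in [set: int * int]) ((fun y => y + (n.1%:~R, n.2%:~R)) @^-1` U).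
  apply/seteqP; split=> [y [u Uu /torus_pi_lift[p [q e]]]|y [[p q] _ Uy]].
    by exists (p, q) => //=; rewrite -e.
  by exists (y + (p%:~R, q%:~R)) => //; exact: torus_pi_int.
apply: bigcup_open => n _; apply: open_comp => // y _.
apply: continuousD; [exact: cvg_id|exact: cvg_cst].
Qed.

Definition torus_map (F : R * R -> R * R) : torus R -> torus R :=
  fun t => torus_pi (F (repr t)).

Definition commutes_Z2 (F : R * R -> R * R) :=
  forall x (p q : int), F (x + (p%:~R, q%:~R)) = F x + (p%:~R, q%:~R).

Lemma torus_mapE F x : commutes_Z2 F -> torus_map F (torus_pi x) = torus_pi (F x).
Proof.
move=> FZ; rewrite /torus_map.
have [p [q e]] := torus_pi_lift (torus_pi_reprK (torus_pi x)).
by rewrite e FZ torus_pi_int.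
Qed.

Lemma torus_map_lift F : continuous F -> commutes_Z2 F -> is_lift (torus_map F) F.
Proof. by move=> cF FZ; split=> // x; exact: torus_mapE. Qed.

Lemma torus_map_homotopic F : continuous F -> commutes_Z2 F -> homotopic_to_id (torus_map F).
Proof.
move=> cF FZ.
(* The straight-line homotopy from the identity to [F] is equivariant, as
   [F x - x] is periodic. *)
pose L (s : R) x := x + s *: (F x - x).
pose H (z : R * torus R) := torus_pi (L z.1 (repr z.2)).
have LZ s x (p q : int) : L s (x + (p%:~R, q%:~R)) = L s x + (p%:~R, q%:~R).
  by rewrite /L FZ opprD addrACA subrr addr0 addrAC.
have HE s x : H (s, torus_pi x) = torus_pi (L s x) by exact: (@torus_mapE (L s)).
have cL : continuous (fun z : R * (R * R) => L z.1 z.2).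
  move=> z; apply: continuousD; first exact: cvg_snd.
  apply: (@continuousZ _ _ _ fst (fun z => F z.2 - z.2)); first exact: cvg_fst.
  apply: continuousB; last exact: cvg_snd.
  by apply: (@continuous_comp _ _ _ snd F); [exact: cvg_snd|exact: cF].
exists H; split.
- apply: continuous_subspaceT => -[s t] U; rewrite -(torus_pi_reprK t) HE => nU.
  have : nbhs (s, repr t) ((fun z : R * (R * R) => torus_pi (L z.1 z.2)) @^-1` U).
    apply: (@continuous_comp _ _ _ (fun z : R * (R * R) => L z.1 z.2) (@torus_pi R));
      last exact: nU.
      exact: cL.
    exact: torus_pi_continuous.
  move=> [[A B] [/= nA nB] AB].
  exists (A, @torus_pi R @` B); first by split=> //=; exact: torus_pi_nbhs.
  move=> [s' _] [/= As' [b Bb <-]]; rewrite /= HE.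
  exact: (AB (s', b)).
- by move=> t; rewrite /H /L /= scale0r addr0 torus_pi_reprK.
- by move=> t; rewrite /H /L /torus_map /= scale1r addrC subrK.
Qed.

Lemma torus_mapK F F' : commutes_Z2 F -> commutes_Z2 F' -> cancel F F' ->
  cancel (torus_map F) (torus_map F').
Proof.
by move=> FZ FZ' FK t; rewrite -(torus_pi_reprK t) !torus_mapE// FK.
Qed.

Lemma fwd_commutes P : commutes_Z2 (fwd P).
Proof. by move=> x p q; exact: fwd_Z. Qed.

Lemma bwd_commutes P : commutes_Z2 (bwd P).
Proof. exact: (@fwd_commutes (auto_inv P)). Qed.

Lemma torus_map_diffeo P : diffeomorphism (torus_map (fwd P)).
Proof.
exists (torus_map (bwd P)); split.
- exact: (torus_mapK (@fwd_commutes P) (@bwd_commutes P) (@fwdK _ P)).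
- exact: (torus_mapK (@bwd_commutes P) (@fwd_commutes P) (@bwdK _ P)).
- exists (fwd P); split; last exact: fwd_smooth.
  by apply: torus_map_lift; [exact: fwd_cont|exact: fwd_commutes].
- exists (bwd P); split; last exact: bwd_smooth.
  by apply: torus_map_lift; [exact: bwd_cont|exact: bwd_commutes].
Qed.

Lemma fwd_C_omega P (rho : {posnum R}) : C_omega rho%:num (fun x => fwd P x - x).
Proof.
have hx : holomorphic_extension rho%:num (fun x => fwd P x - x) (fun z => fwdC P z - z).
  split=> [z _|x]; last by rewrite fwd_ext embC2D embC2N.
  apply: differentiableB; first exact: fwdC_holo.
  by have [D _] := is_diff_id z; exact: D.
split.
- by move=> x p q; rewrite fwd_Z opprD addrACA subrr addr0.
- by exists (fun z => fwdC P z - z).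
- have [C C0 hC] := commutes_Z2C_bounded rho%:num (@fwdC_cont _ P) (@fwdC_Z _ P).
  apply: (@le_lt_trans _ _ C%:E); last exact: ltry.
  apply: (@le_trans _ _ (sup_strip rho%:num (fun z => fwdC P z - z))).
    by apply: ereal_inf_lbound; exists (fun z => fwdC P z - z).
  apply: ge_ereal_sup => _ [z [z1 z2] <-]; rewrite lee_fin; apply: hC; exact: ltW.
Qed.

Section diff_of_auto.
Variables (rho : {posnum R}) (P : entire_auto R).
Let lift : exists2 F, is_lift (torus_map (fwd P)) F & C_omega rho%:num (fun x => F x - x).
Proof.
exists (fwd P); last exact: fwd_C_omega.
by apply: torus_map_lift; [exact: fwd_cont|exact: fwd_commutes].
Qed.
Definition diff_of_auto : Diff_omega rho :=
  MkDiffOmega (torus_map_diffeo P) (torus_map_homotopic (@fwd_cont _ P) (@fwd_commutes P)) lift.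
End diff_of_auto.

Lemma diff_of_auto_lift rho P : is_lift (diff_of_auto rho P) (fwd P).
Proof. by apply: torus_map_lift; [exact: fwd_cont|exact: fwd_commutes]. Qed.

Lemma is_lift_biholomorphic P f F : is_lift f (fwd P) -> is_lift f F ->
  biholomorphic_extension F.
Proof.
move=> fP fF; have [p [q e]] := lift_unique fF fP.
pose Q := auto_comp (auto_translation (p%:~R, q%:~R)) P.
exists (fwdC Q), (bwdC Q); split; [|exact: fwdCK|exact: bwdCK|exact: fwdC_holo|exact: bwdC_holo].
by move=> x; rewrite fwd_ext e.
Qed.

Lemma rotation_conj_mem rho P a :
  conjugate_rotations rho (diff_of_auto rho (rotation_conj P a)).
Proof.
exists (diff_of_auto rho P), (torus_map (bwd P)), (torus_pi a); split.
- exact: (torus_mapK (@fwd_commutes P) (@bwd_commutes P) (@fwdK _ P)).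
- exact: (torus_mapK (@bwd_commutes P) (@fwd_commutes P) (@bwdK _ P)).
- by move=> H; apply: is_lift_biholomorphic; exact: diff_of_auto_lift.
- apply/funext => t; rewrite -(torus_pi_reprK t) /= /rotation.
  rewrite (torus_mapE _ (@bwd_commutes P)) -torus_piD (torus_mapE _ (@fwd_commutes P)).
  by rewrite (torus_mapE _ (@fwd_commutes (rotation_conj P a))).
Qed.

(** The biholomorphic extension of a lift is only known to agree with it on the
    real plane; that it commutes with integer translations is an instance of the
    identity theorem. *)
Lemma Diff_omega_auto rho (h : Diff_omega rho) (h' : torus R -> torus R) :
  cancel h h' -> cancel h' h -> (forall H, is_lift h H -> biholomorphic_extension H) ->
  exists P, is_lift h (fwd P) /\ is_lift h' (bwd P).
Proof.
move=> hK h'K hb.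
have [H hH [HZ _ _]] := diff_lift h.
have {}HZ : commutes_Z2 H.
  move=> x p q; have := HZ x p q => /(congr1 (+%R^~ (x + (p%:~R, q%:~R)))).
  by rewrite subrK addrA subrK.
have [g [hg gh [Hs [hHs sHs]] [Gs [gGs sGs]]]] := diff_diffeo h.
have gh' : g = h'.
  by apply/funext => t; rewrite -[in LHS](h'K t) hg.
subst g.
have smooth_shift (F F' : R * R -> R * R) f : is_lift f F -> is_lift f F' ->
    (forall k, class_C k F') -> forall k, class_C k F.
  move=> fF fF' sF' k; have [p [q e]] := lift_unique fF fF'.
  have -> : F = (fun x => x + (p%:~R, q%:~R)) \o F' by apply/funext => x; rewrite e.
  by apply: class_C_comp; [exact: class_C_translation|exact: sF'].
have sH := smooth_shift _ _ _ hH hHs sHs.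
(* A lift of the inverse is an inverse of the lift up to an integer vector,
   which is subtracted. *)
have idH : is_lift (fun t : torus R => t) (Gs \o H).
  split=> [x|x].
    by apply: continuous_comp; [exact: (proj1 hH)|exact: (proj1 gGs)].
  by rewrite /= -(proj2 gGs) -(proj2 hH) hK.
have idid : is_lift (fun t : torus R => t) (fun x : R * R => x).
  by split=> // x; exact: cvg_id.
have [p [q e]] := lift_unique idH idid.
pose H' x := Gs x + (- (p%:~R), - (q%:~R)).
have hH' : is_lift h' H'.
  split=> [x|x].
    apply: continuousD; [exact: (proj1 gGs)|exact: cvg_cst].
  by rewrite (proj2 gGs) /H' -!intrN torus_pi_int.
have HK : cancel H H'.
  move=> x; rewrite /H' -[Gs (H x)]/((Gs \o H) x) e -addrA.
  by rewrite -[(- _, _)]/(- (p%:~R, q%:~R)) subrr addr0.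
have H'K : cancel H' H.
  have idH' : is_lift (fun t : torus R => t) (H \o H').
    split=> [x|x].
      by apply: continuous_comp; [exact: (proj1 hH')|exact: (proj1 hH)].
    by rewrite /= -(proj2 hH) -(proj2 hH') h'K.
  have [m [n e']] := lift_unique idH' idid.
  move=> x; have := e' (H 0); rewrite /= HK => /eqP.
  rewrite addrC -subr_eq subrr => /eqP mn.
  by have := e' x; rewrite /= -mn addr0.
have sH' := smooth_shift _ _ _ hH' gGs sGs.
have [G [K [GH GK KG hoG hoK]]] := hb _ hH.
have GZ : commutes_Z2C G.
  move=> z m n; apply/eqP; rewrite -subr_eq0 opprD addrA; apply/eqP.
  apply: (@entire_zero R (fun z => G (z + intC2 R m n) - G z - intC2 R m n)) => [w _|x].
    apply: differentiableB; last exact: differentiable_cst.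
    apply: differentiableB; last exact: hoG.
    apply: (@differentiable_comp _ _ _ _ (fun w => w + intC2 R m n) G); last exact: hoG.
    apply: differentiableD; last exact: differentiable_cst.
    by have [D _] := is_diff_id w; exact: D.
  by rewrite /intC2 -embC2D !GH HZ embC2D addrAC addrK subrr.
have KH : extends K H'.
  by move=> x; rewrite -{1}(H'K x) -GH GK.
by exists (EntireAuto GH KH GK KG hoG hoK GZ sH sH').
Qed.

Lemma conjugate_rotations_auto rho (f : Diff_omega rho) : conjugate_rotations rho f ->
  exists P a, f = diff_of_auto rho (rotation_conj P a).
Proof.
move=> [h [h' [a [hK h'K hb fE]]]].
have [P [hP hP']] := Diff_omega_auto hK h'K hb.
exists P, (repr a); apply: Diff_omega_inj => t.
rewrite fE -(torus_pi_reprK t) -[in LHS](torus_pi_reprK a) /= /rotation.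
rewrite (proj2 hP') -torus_piD (proj2 hP).
by rewrite (torus_mapE _ (@fwd_commutes (rotation_conj P (repr a)))).
Qed.

Lemma dist_of_auto rho P Q (e : R) :
  (norm_strip rho%:num (fun x => fwd P x - fwd Q x)%R <= e%:E)%E ->
  dist_rho (diff_of_auto rho P) (diff_of_auto rho Q) <= e.
Proof.
move=> h; rewrite -lee_fin -edist_rhoE; apply: le_trans h.
apply: ereal_inf_lbound; exists (fwd P), (fwd Q), 0, 0; split; [exact: diff_of_auto_lift..|].
by congr norm_strip; apply/funext => x; rewrite addr0.
Qed.

End torus_realization.

(** * Spreading small sets over large balls *)

Section spreading.
Variable R : realType.
Implicit Types (P Q : entire_auto R) (x y : R * R).

Lemma norm2N x : norm2 (- x) = norm2 x.
Proof. by rewrite /norm2 /= !sqrrN. Qed.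

Lemma norm2_open (U : set (R * R)) x : open U -> U x ->
  exists2 r : R, 0 < r & forall y, norm2 (y - x) < r -> U y.
Proof.
move=> oU Ux; have /nbhs_ballP[r /= r0 hr] : nbhs x U by exact: open_nbhs_nbhs.
exists r => // y yx; apply: hr; split; rewrite /ball /= distrC.
  exact: (le_lt_trans (norm2_fst (y - x)) yx).
exact: (le_lt_trans (norm2_snd (y - x)) yx).
Qed.

Lemma cos_surj (Q : nat) (s0 c : R) : (0 < Q)%N -> -1 <= c <= 1 ->
  exists2 s, s0 <= s <= s0 + Q%:R^-1 & cos (2 * pi * Q%:R * s) = c.
Proof.
move=> Q0 c1; have Q0' : 0 < Q%:R :> R by rewrite ltr0n.
have pi0 : 0 < pi :> R by exact: pi_gt0.
pose w := acos c / (2 * pi) - Q%:R * s0.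
have w1 := floor_le w; have w2 := floorD1_gt w.
rewrite intrD in w2.
exists (s0 + (w - (Num.floor w)%:~R) / Q%:R).
  apply/andP; split; first by rewrite lerDl divr_ge0 ?(ltW Q0')// subr_ge0.
  by rewrite lerD2l -[leRHS]mul1r ler_pM2r ?invr_gt0//; lra.
have -> : 2 * pi * Q%:R * (s0 + (w - (Num.floor w)%:~R) / Q%:R) =
  acos c + 2 * pi * (- Num.floor w)%:~R.
  have key (p k A f : R) : 0 < p -> 0 < k ->
      2 * p * k * (s0 + (A / (2 * p) - k * s0 - f) / k) = A + 2 * p * - f.
    by move=> p0 k0; field; rewrite !gt_eqF.
  by rewrite intrN; exact: key.
by rewrite cos_periodz acosK.
Qed.

Section stretching.
Variables (N : R) (Q : nat).
Hypotheses (N0 : 0 < N) (Q0 : (0 < Q)%N).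

Definition stretch := auto_comp (auto_hshear N Q) (auto_vshear N Q).

Definition half_period : R * R := (Q%:R^-1 / 2, 0).

(** Translating by half a period turns the second shear into its inverse, so the
    vertical displacement [- wave N Q X] occurs twice. *)
Lemma stretch_conjE (X y0 : R) : let Y := y0 - 2 * wave N Q X in
  fwd (rotation_conj stretch half_period) (X + wave N Q y0, y0) =
  (X + Q%:R^-1 / 2 + wave N Q Y, Y).
Proof.
have half (t : R) : wave N Q (t + Q%:R^-1 / 2) = - wave N Q t.
  rewrite /wave -mulrN -cosDpi; congr (_ * cos _).
  by field; rewrite pnatr_eq0 -lt0n.
have waveN (t : R) : wave (- N) Q t = - wave N Q t by rewrite /wave mulNr.
rewrite /= /hshear /vshear /= !waveN addrK addr0 half.
by have -> : y0 - wave N Q X - wave N Q X = y0 - 2 * wave N Q X by ring.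
Qed.

(** Starting from the points [(u, y0)] of a segment as long as a period, the
    vertical displacement takes all values in [[-2 N, 2 N]], and so fills
    heights far apart; as each height [Y] may be altered by up to a period, the
    horizontal displacement [wave N Q Y] may be prescribed in [[-N, N]]. *)
Lemma stretch_dense (x0 y0 r e : R) : Q%:R^-1 < r -> Q%:R^-1 < e / 2 -> Q%:R^-1 < N ->
  exists c, forall x, norm2 (x - c) < N -> exists2 u, `|u - x0| < r &
    norm2 (fwd (rotation_conj stretch half_period) (u, y0) - x) < e.
Proof.
move=> Qr Qe QN; pose X0 := x0 - wave N Q y0.
have Qi0 : 0 < Q%:R^-1 :> R by rewrite invr_gt0 ltr0n.
exists (X0 + Q%:R^-1 / 2, y0) => -[a b] xc.
have /= := le_lt_trans (norm2_fst _) xc; have /= := le_lt_trans (norm2_snd _) xc.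
rewrite !ltr_norml => /andP[b1 b2] /andP[a1 a2].
(* The height [Y] within one period above [b] is chosen first, so that the
   last shear brings [X0] to [a]; then [X] within one period of [X0], so that
   the vertical shear brings [y0] to [Y]. *)
have [|Y Yb cY] := @cos_surj Q b ((a - (X0 + Q%:R^-1 / 2)) / N) Q0.
  by rewrite ler_pdivlMr// ler_pdivrMr//; lra.
have [|X XX cX] := @cos_surj Q X0 ((y0 - Y) / (2 * N)) Q0.
  by rewrite ler_pdivlMr ?mulr_gt0// ler_pdivrMr ?mulr_gt0//; lra.
have wX : wave N Q X = (y0 - Y) / 2 by rewrite /wave cX; field; rewrite gt_eqF.
have wY : wave N Q Y = a - (X0 + Q%:R^-1 / 2) by rewrite /wave cY mulrC divfK ?gt_eqF.
exists (X + wave N Q y0).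
  have -> : X + wave N Q y0 - x0 = X - X0 by rewrite /X0; ring.
  rewrite ger0_norm; lra.
have := stretch_conjE X y0; rewrite /= wX.
have -> : y0 - 2 * ((y0 - Y) / 2) = Y by field.
rewrite wY => ->; apply: le_lt_trans (norm2_le_sum _) _ => /=.
have -> : X + Q%:R^-1 / 2 + (a - (X0 + Q%:R^-1 / 2)) - a = X - X0 by ring.
rewrite !ger0_norm; lra.
Qed.

Lemma stretch_shift (q : nat) (p1 p2 : int) x : (0 < q)%N -> (q %| Q)%N ->
  fwd stretch (x + (p1%:~R / q%:R, p2%:~R / q%:R)) =
  fwd stretch x + (p1%:~R / q%:R, p2%:~R / q%:R).
Proof.
move=> q0 qQ; case: x => x y /=; rewrite /hshear /vshear /= wave_shift//.
by rewrite [y + _ + _]addrAC wave_shift// [x + _ + _]addrAC.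
Qed.

End stretching.

Lemma iter_rotation_conj P (b : R * R) n x :
  iter n (fwd (rotation_conj P b)) x = fwd P (bwd P x + b *+ n).
Proof.
elim: n => [|n IH]; first by rewrite addr0 bwdK.
by rewrite iterS IH /= fwdK mulrSr addrA.
Qed.

Definition spreads (F : R * R -> R * R) (U : set (R * R)) (e N : R) :=
  exists n : nat, (0 < n)%N /\ exists c : R * R, forall x, norm2 (x - c) < N ->
    exists2 y, U y & norm2 (iter n F y - x) < e.

(** The denominator can be any large integer, so that it can be shared by the two
    coordinates of a vector. *)
Lemma rational_approx (a d : R) : 0 < d -> exists q : nat, forall m : nat, (q <= m)%N ->
  (0 < m)%N /\ exists p : int, `|p%:~R / m%:R - a| < d.
Proof.
move=> d0; pose q := (Num.bound d^-1).+1; exists q => m qm.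
have m0 : (0 < m)%N by apply: leq_trans qm.
split=> //; exists (Num.floor (a * m%:R)).
have m0' : 0 < m%:R :> R by rewrite ltr0n.
have dm : 1 < d * m%:R.
  rewrite -ltr_pdivrMl// mulr1.
  have /lt_le_trans := archi_boundP (ltW (eqbRL (invr_gt0 d) d0)); apply.
  by rewrite ler_nat; apply: leq_trans qm.
have w1 := floor_le (a * m%:R); have w2 := floorD1_gt (a * m%:R).
rewrite intrD in w2.
have -> : (Num.floor (a * m%:R))%:~R / m%:R - a =
  ((Num.floor (a * m%:R))%:~R - a * m%:R) / m%:R.
  by field; rewrite gt_eqF.
rewrite normrM normfV (gtr0_norm m0') ltr_pdivrMr// ler0_norm; lra.
Qed.

(** The choices are made in this order: a rational vector [a'] close to [a]; the
    frequency of the shears, which depends on [P], [U] and the denominator of [a'];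
    finally [b], so close to [a'] that the shears do no harm in the norm of the
    strip. *)
Lemma spreading_dense (rho : {posnum R}) P (a : R * R) (U : set (R * R)) (d e N : R) :
  open U -> U !=set0 -> 0 < d -> 0 < e -> 0 < N ->
  exists P' b, dist_rho (diff_of_auto rho (rotation_conj P a))
      (diff_of_auto rho (rotation_conj P' b)) < d
    /\ spreads (fwd (rotation_conj P' b)) U e N.
Proof.
move=> oU [u0 Uu0] d0 e0 N0.
have d40 : 0 < d / 4 by rewrite divr_gt0.
have [d1 d10 hd1] := rotation_conj_close P rho a d40.
have d120 : 0 < d1 / 2 by rewrite divr_gt0.
have [q1 hq1] := rational_approx a.1 d120; have [q2 hq2] := rational_approx a.2 d120.
pose q := maxn q1 q2.
have [q0 [p1 hp1]] := hq1 q (leq_maxl _ _); have [_ [p2 hp2]] := hq2 q (leq_maxr _ _).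
pose a' : R * R := (p1%:~R / q%:R, p2%:~R / q%:R).
have aa' : norm2 (a' - a) < d1.
  by apply: le_lt_trans (norm2_le_sum _) _; rewrite /=; lra.
have e20 : 0 < e / 2 by rewrite divr_gt0.
have [d2 d20 hd2] := fwd_unif P e20.
have [C C0 hC] := fwd_bounded P.
have [r r0 hr] : exists2 r : R, 0 < r & forall y, norm2 (y - bwd P u0) < r -> U (fwd P y).
  apply: (@norm2_open (fwd P @^-1` U)); last by rewrite /= bwdK.
  by apply: open_comp => // y _; exact: fwd_cont.
(* [P] moves points by at most [C], whence the larger radius. *)
pose M := N + C.
have M0 : 0 < M by rewrite addr_gt0.
pose eps := Num.min r (Num.min (d2 / 2) M).
have eps0 : 0 < eps by rewrite !lt_min r0 M0 divr_gt0.
pose Q := (q * (Num.bound eps^-1).+1)%N.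
have Q0 : (0 < Q)%N by rewrite muln_gt0 q0.
have Qeps : Q%:R^-1 < eps.
  rewrite -[eps]invrK ltf_pV2 ?posrE ?invr_gt0// ?ltr0n//.
  have /lt_le_trans := archi_boundP (ltW (eqbRL (invr_gt0 eps) eps0)); apply.
  by rewrite ler_nat /Q; apply: leq_trans (leqnSn _) _; apply: leq_pmull.
move: Qeps; rewrite !lt_min => /and3P[Qr Qd2 QM].
have [c hc] := stretch_dense M0 Q0 (bwd P u0).1 (bwd P u0).2 Qr Qd2 QM.
pose G := stretch M Q; pose P' := auto_comp P G.
have Ga y : fwd G (bwd G y + a') = y + a' by rewrite stretch_shift ?dvdn_mulr// bwdK.
have P'a' : fwd (rotation_conj P' a') = fwd (rotation_conj P a').
  apply/funext => x; apply: (congr1 (fwd P)).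
  exact: Ga.
have [d3 d30 hd3] := rotation_conj_close P' rho a' d40.
pose t : R * R := half_period Q.
pose m := (Num.bound d3^-1).+1.
have mq0 : (0 < m * q)%N by rewrite muln_gt0.
have mq0' : 0 < (m * q)%:R :> R by rewrite ltr0n.
pose b := a' + (t.1 / (m * q)%:R, 0).
have t1 : 0 <= t.1 <= 1.
  have : Q%:R^-1 <= 1 :> R by rewrite invf_le1 ?ltr0n// ler1n.
  have : 0 <= Q%:R^-1 :> R by rewrite invr_ge0.
  rewrite /t /half_period /=; lra.
(* After [m q] steps the rotation by [b] is the rotation by [t] modulo integers. *)
have bmq : b *+ (m * q) = ((m%:Z * p1)%:~R, (m%:Z * p2)%:~R) + t.
  have mulrn_pair (z : R * R) k : z *+ k = (z.1 *+ k, z.2 *+ k).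
    by elim: k => [|k IH]; rewrite ?mulr0n// !mulrS IH.
  rewrite mulrn_pair /b /=; congr (_, _).
    rewrite -[LHS]mulr_natr intrM natrM /=; field.
    by rewrite !pnatr_eq0 -!lt0n Q0 q0.
  rewrite addr0 /= addr0 -[_ *+ (m * q)]mulr_natr intrM natrM /=; field.
  by rewrite !pnatr_eq0 -!lt0n q0.
have ba' : norm2 (b - a') < d3.
  rewrite /b [a' + _]addrC addrK; apply: le_lt_trans (norm2_le_sum _) _ => /=.
  have tm : 0 <= t.1 / (m * q)%:R by apply: divr_ge0; [case/andP: t1|exact: ltW].
  rewrite normr0 addr0 ger0_norm//.
  rewrite ltr_pdivrMr//; apply: (@le_lt_trans _ _ 1); first by case/andP: t1.
  rewrite -ltr_pdivrMl// mulr1.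
  have /lt_le_trans := archi_boundP (ltW (eqbRL (invr_gt0 d3) d30)); apply.
  by rewrite ler_nat; apply: leq_trans (leqnSn _) _; apply: leq_pmulr.
exists P', b; split.
  apply: (@le_lt_trans _ _ (d / 4 + d / 4)); last by lra.
  apply: le_trans (dist_rho_triangle (diff_of_auto rho (rotation_conj P a')) _ _) _.
  apply: lerD.
    by rewrite dist_rho_sym; apply: dist_of_auto; exact: hd1.
  by rewrite dist_rho_sym; apply: dist_of_auto; rewrite -P'a'; exact: hd3.
exists (m * q)%N; split=> //.
pose v : R * R := ((m%:Z * p1)%:~R, (m%:Z * p2)%:~R).
exists (c + v) => x xc.
pose x' := x - v.
have x'c : norm2 (bwd P x' - c) < M.
  have -> : bwd P x' - c = (bwd P x' - x') + (x' - c) by rewrite addrA subrK.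
  apply: le_lt_trans (ler_norm2D _ _) _; rewrite addrC; apply: ltr_leD.
    by move: xc; rewrite /x' opprD addrA addrAC.
  have := hC (bwd P x'); rewrite bwdK -norm2N opprB; exact: id.
have [u ur hu] := hc _ x'c.
set y' := (u, (bwd P u0).2) in hu.
exists (fwd P y').
  apply: hr; apply: le_lt_trans (norm2_le_sum _) _.
  by rewrite /= subrr normr0 addr0.
rewrite iter_rotation_conj bmq -/v.
have -> : bwd P' (fwd P y') = bwd G y' by rewrite /= fwdK.
rewrite addrCA [v + _]addrC (fwd_Z P' _ (m%:Z * p1) (m%:Z * p2)).
have -> : fwd P' (bwd G y' + t) = fwd P (fwd (rotation_conj G t) y') by [].
have := hd2 _ _ hu; rewrite bwdK /x' opprB -/v -addrA => h.
by apply: le_lt_trans h _; lra.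
Qed.

Lemma iter_close (F : R * R -> R * R) :
  (forall e : R, 0 < e -> exists2 d : R, 0 < d &
     forall x y, norm2 (y - x) < d -> norm2 (F y - F x) <= e) ->
  forall n (e : R), 0 < e -> exists2 d : R, 0 < d & forall K : R * R -> R * R,
    (forall x, norm2 (K x - F x) < d) -> forall x, norm2 (iter n K x - iter n F x) < e.
Proof.
move=> uF; elim=> [|n IH] e e0.
  by exists 1 => // K _ x; rewrite /= subrr /norm2 /= !expr0n addr0 sqrtr0.
have e20 : 0 < e / 2 by rewrite divr_gt0.
have [d1 d10 h1] := uF _ e20; have [d2 d20 h2] := IH _ d10.
exists (Num.min d2 (e / 2)); first by rewrite lt_min d20.
move=> K hK x; rewrite !iterS.
set k := iter n K x; set f := iter n F x.
have -> : K k - F f = (K k - F k) + (F k - F f) by rewrite addrA subrK.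
apply: le_lt_trans (ler_norm2D _ _) _; rewrite [e]splitr; apply: ltr_leD.
  by have := hK k; rewrite lt_min => /andP[].
by apply: h1; apply: h2 => z; have := hK z; rewrite lt_min => /andP[].
Qed.

(** The loss from [e / 2] to [e] absorbs the distance between the iterates, which
    is controlled uniformly on the plane. *)
Lemma spreading_open (rho : {posnum R}) P (U : set (R * R)) (e N : R) : 0 < e ->
  spreads (fwd P) U (e / 2) N -> exists2 d : R, 0 < d & forall g : Diff_omega rho,
    dist_rho (diff_of_auto rho P) g < d -> exists2 K, is_lift g K & spreads K U e N.
Proof.
move=> e0 [n [n0 [c hc]]]; have e20 : 0 < e / 2 by rewrite divr_gt0.
have [d d0 hd] := iter_close (@fwd_unif _ P) n e20.
exists d => // g; rewrite -lte_fin -edist_rhoE => /ereal_inf_lt[_ [H [K [p [q [hH hK ->]]]]] lt].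
have [p' [q' HE]] := lift_unique hH (@diff_of_auto_lift R rho P).
pose K' x := K x + ((- p - p')%:~R, (- q - q')%:~R).
exists K'.
  split=> [x|x]; first by apply: continuousD; [exact: (proj1 hK)|exact: cvg_cst].
  by rewrite (proj2 hK) /K' torus_pi_int.
exists n; split=> //; exists c => x /hc[y Uy hy]; exists y => //.
have -> : iter n K' y - x = (iter n K' y - iter n (fwd P) y) + (iter n (fwd P) y - x).
  by rewrite addrA subrK.
apply: le_lt_trans (ler_norm2D _ _) _; rewrite [e]splitr; apply: ltrD => //.
apply: hd => z; rewrite -norm2N -lte_fin; apply: le_lt_trans lt.
apply: le_trans _ (norm_strip_ge rho _ z).
rewrite lee_fin HE /K' !intrB !intrN le_eqVlt; apply/orP; left; apply/eqP; congr norm2.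
by case: (K z) (fwd P z) => [k1 k2] [f1 f2]; congr (_, _) => /=; ring.
Qed.

(** The iterate of order [n] is moved by [n] times the integer vector, and the
    centre of the ball follows. *)
Lemma spreads_shift (F : R * R -> R * R) (p q : int) U e N : commutes_Z2 F -> spreads F U e N ->
  spreads (fun x => F x + (p%:~R, q%:~R)) U e N.
Proof.
move=> FZ [n [n0 [c hc]]]; exists n; split=> //.
pose v : R * R := ((p * n%:Z)%:~R, (q * n%:Z)%:~R).
exists (c + v) => x; rewrite opprD addrA addrAC => /hc[y Uy hy]; exists y => //.
suff -> : iter n (fun x => F x + (p%:~R, q%:~R)) y = iter n F y + v.
  by move: hy; rewrite opprB addrA.
rewrite /v; elim: n {n0 hc v hy} => [|n IH]; first by rewrite !mulr0 addr0.
rewrite !iterS IH FZ -addrA; congr (_ + _); congr (_, _); rewrite /= -intrD; congr (_%:~R);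
  by rewrite -addn1 PoszD mulrDr mulr1.
Qed.

End spreading.

(** * Residuality *)

Section residuality.
Variables (R : realType) (rho : {posnum R}).

Definition ball2 (c : R * R) (r : R) : set (R * R) := [set y | norm2 (y - c) < r].

Lemma ball2_open c r : open (ball2 c r).
Proof.
rewrite openE => x xc; apply/nbhs_ballP.
have d0 : 0 < (r - norm2 (x - c)) / 2 by rewrite divr_gt0// subr_gt0.
exists ((r - norm2 (x - c)) / 2) => // y [/= h1 h2]; rewrite /ball2 /=.
have -> : y - c = (y - x) + (x - c) by rewrite addrA subrK.
apply: le_lt_trans (ler_norm2D _ _) _; rewrite -ltrBrDr.
apply: le_lt_trans (norm2_le_sum _) _; move: h1 h2; rewrite /ball /= => h1 h2.
by rewrite [ltRHS]splitr; apply: ltrD; rewrite distrC.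
Qed.

Definition spreading_diffs (i : rat * rat * nat) : set (closure_O rho) :=
  [set f | exists2 K, is_lift (set_val f : Diff_omega rho) K &
    spreads K (ball2 (ratr i.1.1, ratr i.1.2) (i.2.+1%:R^-1)) (i.2.+1%:R^-1) (i.2.+1%:R)].

Lemma nbhs_Diff_omega (g : Diff_omega rho) (A : set (Diff_omega rho)) :
  nbhs g A <-> exists2 d : R, 0 < d & forall k, dist_rho g k < d -> A k.
Proof.
split=> [/nbhs_ballP[d /= d0 h]|[d d0 h]]; first by exists d.
by apply/nbhs_ballP; exists d.
Qed.

(** An element of the closure is approximated by a conjugate of a rotation, which
    is perturbed to a spreading one; the latter lies in the interior by
    [spreading_open]. *)
Lemma spreading_diffs_dense i : dense ((spreading_diffs i)^°).
Proof.
move=> W [f Wf] [V oV VW].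
have fV : nbhs (set_val f : Diff_omega rho) V.
  by apply: open_nbhs_nbhs; split; [exact: oV|rewrite -VW in Wf].
have /(_ _ fV)[g [/conjugate_rotations_auto[P [a ->]] gV]] :
    closure (conjugate_rotations rho) (set_val f : Diff_omega rho) by exact: set_valP.
have /nbhs_Diff_omega[d d0 hd] : nbhs (diff_of_auto rho (rotation_conj P a)) V.
  exact: open_nbhs_nbhs.
pose eps : R := i.2.+1%:R^-1.
have eps0 : 0 < eps by rewrite invr_gt0 ltr0n.
have eps20 : 0 < eps / 2 by rewrite divr_gt0.
have [] := @spreading_dense R rho P a (ball2 (ratr i.1.1, ratr i.1.2) eps) d
  (eps / 2) i.2.+1%:R.
- exact: ball2_open.
- by exists (ratr i.1.1, ratr i.1.2); rewrite /ball2 /= subrr /norm2 /= !expr0n addr0 sqrtr0.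
- exact: d0.
- exact: eps20.
- by rewrite ltr0n.
move=> P' [b [dist_lt spr]].
pose k := diff_of_auto rho (rotation_conj P' b).
have kO : k \in closure_O rho.
  by apply/mem_set; apply: subset_closure; exact: rotation_conj_mem.
have [d' d'0 hd'] := spreading_open rho eps0 spr.
exists (exist _ k kO : closure_O rho); split.
  by rewrite -VW /=; apply: hd.
have nk : nbhs k [set g : Diff_omega rho | dist_rho k g < d'] by apply/nbhs_Diff_omega; exists d'.
rewrite /interior /=.
have H : nbhs (exist _ k kO : closure_O rho)
    ((set_val : closure_O rho -> Diff_omega rho) @^-1` [set g | dist_rho k g < d']).
  exact: (@initial_continuous (closure_O rho) (Diff_omega rho) set_val (exist _ k kO) _ nk).
by apply: filterS H => g'; exact: hd'.
Qed.

Lemma rational_ball (U : set (R * R)) (e N : R) : open U -> U !=set0 -> 0 < e -> 0 < N ->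
  exists i : rat * rat * nat, [/\ ball2 (ratr i.1.1, ratr i.1.2) (i.2.+1%:R^-1) `<=` U,
    i.2.+1%:R^-1 <= e & N <= i.2.+1%:R].
Proof.
move=> oU [x Ux] e0 N0; have [r r0 hr] := norm2_open oU Ux.
pose m := Num.min (r / 4) e.
have m0 : 0 < m by rewrite lt_min e0 divr_gt0.
pose k := maxn (Num.bound m^-1) (Num.bound N).
have k0 : 0 < k.+1%:R :> R by rewrite ltr0n.
have km : k.+1%:R^-1 < m.
  rewrite -[m]invrK ltf_pV2 ?posrE ?invr_gt0//.
  have /lt_le_trans := archi_boundP (ltW (eqbRL (invr_gt0 m) m0)); apply.
  by rewrite ler_nat; apply: leq_trans (leqnSn _); exact: leq_maxl.
move: km; rewrite lt_min => /andP[kr ke].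
have [q1 hq1] : exists q : rat, ratr q \in `]x.1 - r / 4, x.1 + r / 4[.
  by apply: rat_in_itvoo; lra.
have [q2 hq2] : exists q : rat, ratr q \in `]x.2 - r / 4, x.2 + r / 4[.
  by apply: rat_in_itvoo; lra.
move: hq1 hq2; rewrite !in_itv /= => /andP[a1 a2] /andP[b1 b2].
exists (q1, q2, k); split => /=.
- move=> y; rewrite /ball2 /= => yq; apply: hr.
  have -> : y - x = (y - (ratr q1, ratr q2)) + ((ratr q1, ratr q2) - x) by rewrite addrA subrK.
  apply: le_lt_trans (ler_norm2D _ _) _.
  have xq : norm2 ((ratr q1, ratr q2) - x) <= r / 4 + r / 4.
    by apply: le_trans (norm2_le_sum _) _; apply: lerD; rewrite ler_norml /=; lra.
  by apply: le_lt_trans (lerD (ltW yq) xq) _; move: kr; set z := k.+1%:R^-1 => kr; lra.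
- exact: ltW.
- apply: ltW; apply: lt_le_trans (archi_boundP (ltW N0)) _.
  by rewrite ler_nat; apply: leq_trans (leqnSn _); exact: leq_maxr.
Qed.

Lemma Diff_omega_lift_commutes (f : Diff_omega rho) F : is_lift f F -> commutes_Z2 F.
Proof.
move=> fF; have [H hH [HZ _ _]] := diff_lift f.
have [p [q e]] := lift_unique fF hH.
move=> x m n; rewrite !e -[RHS]addrAC; congr (_ + _).
have := HZ x m n => /(congr1 (+%R^~ (x + (m%:~R, n%:~R)))).
by rewrite subrK addrA subrK.
Qed.

Lemma spreading_diffs_weak_spreading (f : closure_O rho) :
  (forall i, spreading_diffs i f) -> weak_spreading (set_val f : Diff_omega rho).
Proof.
move=> H; have [F fF _] := diff_lift (set_val f : Diff_omega rho).
exists F => // U e N oU U0 e0 N0.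
have [i [iU ie iN]] := rational_ball oU U0 e0 N0.
have [K fK Ks] := H i.
have [p [q FK]] := lift_unique fF fK.
have -> : F = fun x => K x + (p%:~R, q%:~R) by apply/funext.
have KZ := Diff_omega_lift_commutes fK.
have [n [n0 [c hc]]] := spreads_shift p q KZ Ks.
exists n; split=> //; exists c => x xc.
have [y yU hy] := hc x (lt_le_trans xc iN).
exists y; first exact: iU.
exact: lt_le_trans hy ie.
Qed.

End residuality.

Unset Implicit Arguments.

Theorem theorem1p4 (R : realType) (rho : {posnum R}) :
  residual [set f : closure_O rho | weak_spreading (set_val f)].
Proof.
pose W n : set (closure_O rho) := if unpickle n is Some i then (spreading_diffs i)^° else setT.
exists W; split=> [n|f Wf].
  rewrite /W; case: unpickle => [i|]; split.
  - exact: open_interior.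
  - exact: spreading_diffs_dense.
  - exact: openT.
  - by move=> V V0 _; rewrite setIT.
apply: spreading_diffs_weak_spreading => i.
have := Wf (pickle i) I; rewrite /W pickleK; exact: interior_subset.
Qed.
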